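(* For every $c'>0$ there is a constant $c>0$ depending only on $c'$ such that the following holds. Let $n\ge1$, $M\ge2$ be integers, let $\sigma>0$, and consider the linear regression model $Y=X\theta^*+W$, where $X$ is a deterministic $n\times M$ real matrix, $\theta^*\in\mathbb{R}^M$, and $W=(W_1,\dots,W_n)^T$ with $W_1,\dots,W_n$ independent random variables such that $\mathbb{E}[W_i]=0$ and $\mathbb{E}[W_i^2]\le\sigma^2$ for $i=1,\dots,n$. Let $\hat\Theta$ be either the set $\hat\Theta^L$ of all Lasso solutions or the set $\hat\Theta^D$ of all Dantzig solutions with tuning parameter $r=\sigma\sqrt{(\log M)^{1+\delta}/n}$, where $\delta>0$; set $c_0=3$ if $\hat\Theta=\hat\Theta^L$ and $c_0=1$ if $\hat\Theta=\hat\Theta^D$. Assume that the Gram matrix $\Psi=\frac1n X^TX$ satisfies $\Psi_{j,j}=1$ for all $1\le j\le M$ and $$\max_{i\ne j}|\Psi_{i,j}|\le\frac{1}{\alpha(1+2c_0)s}$$ for some integer $s\ge1$ and some constant $\alpha>1$, that $M(\theta^* )\le s$, and that $$\frac1n\sum_{i=1}^n\max_{1\le j\le M}|X_{i,j}|^2\le c'.$$ Then $$\mathbb{P}\left(\sup_{\hat\theta\in\hat\Theta}|\hat\theta-\theta^*|_\infty\le c_2r\right)\ge1-\frac{c}{(\log M)^\delta},\qquad\text{where } c_2=\frac32\left(1+\frac{(1+c_0)^2}{(1+2c_0)(\alpha-1)}\right).$$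
   Context: For $z\in\mathbb{R}^d$, $|z|_p=(\sum_j|z_j|^p)^{1/p}$ for $1\le p<\infty$ and $|z|_\infty=\max_j|z_j|$. For $\theta\in\mathbb{R}^M$, $J(\theta)=\{j:\theta_j\ne0\}$ and $M(\theta)=|J(\theta)|$. For $r>0$, the Lasso solution set $\hat\Theta^L$ is the set of all minimizers over $\theta\in\mathbb{R}^M$ of $\frac1n|Y-X\theta|_2^2+2r|\theta|_1$. The Dantzig solution set $\hat\Theta^D$ is the set of all minimizers of $|\theta|_1$ over those $\theta\in\mathbb{R}^M$ satisfying $\left|\frac1nX^T(Y-X\theta)\right|_\infty\le r$. Neither solution set is assumed to be a singleton, and $M$ may exceed $n$. *)

(* Defs.v *)
From HB Require Import structures.
From mathcomp Require Export all_boot all_order all_algebra.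
From mathcomp Require Export all_classical all_reals all_analysis.
Set Implicit Arguments.
Unset Strict Implicit.
Unset Printing Implicit Defensive.
Export Order.TTheory GRing.Theory Num.Theory.
Export numFieldNormedType.Exports.
Local Open Scope classical_set_scope.
Local Open Scope ring_scope.

(* Vectors of R^d are columns 'cV[R]_d.  The sup-norm |z|_oo is the library norm
   `|z| on 'cV[R]_d, i.e., the maximum of the absolute values of the entries
   (lemma mx_normrE). *)

Definition lp_norm (R : realType) (d : nat) (p : R) (z : 'cV[R]_d) : R :=
  (\sum_(j < d) `|z j 0| `^ p) `^ p^-1.

Definition support_set (R : realType) (d : nat) (theta : 'cV[R]_d) : {set 'I_d} :=
  [set j | theta j 0 != 0]%SET.

Definition sparsity (R : realType) (d : nat) (theta : 'cV[R]_d) : nat :=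
  #|support_set theta|.

Definition gram (R : realType) (n M : nat) (X : 'M[R]_(n, M)) : 'M[R]_M :=
  n%:R^-1 *: (X^T *m X).

Definition minimizers (R : realType) (U : Type) (F : set U) (f : U -> R) : set U :=
  [set u | F u /\ forall v, F v -> f u <= f v].

Inductive estimator := Lasso | Dantzig.

Definition solutions (R : realType) (n M : nat) (e : estimator)
    (X : 'M[R]_(n, M)) (r : R) (y : 'cV[R]_n) : set 'cV[R]_M :=
  match e with
  | Lasso =>
      minimizers setT (fun theta =>
        n%:R^-1 * lp_norm 2 (y - X *m theta) ^+ 2 + 2 * r * lp_norm 1 theta)
  | Dantzig =>
      minimizers [set theta | `|n%:R^-1 *: (X^T *m (y - X *m theta))| <= r]
        (fun theta => lp_norm 1 theta)
  end.

Definition c0 (R : realType) (e : estimator) : R :=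
  match e with Lasso => 3 | Dantzig => 1 end.

Definition c2 (R : realType) (e : estimator) (alpha : R) : R :=
  3 / 2 * (1 + (1 + c0 R e) ^+ 2 / ((1 + 2 * c0 R e) * (alpha - 1))).

Definition mutually_independent (R : realType) (d : measure_display)
    (T : measurableType d) (P : probability T R) (I : finType)
    (W : I -> {RV P >-> R}) : Prop :=
  forall (J : {set I}) (B : I -> set R), (forall i, measurable (B i)) ->
    P (\bigcap_(i in [set` J]) (W i @^-1` B i)) =
    (\prod_(i in J) P (W i @^-1` B i))%E.

(* The supremum is taken in the extended reals: the real-valued sup of an
   unbounded set would be 0. *)
Definition sup_error (R : realType) (M : nat) (S : set 'cV[R]_M)
    (theta : 'cV[R]_M) : \bar R :=
  ereal_sup [set `|theta' - theta|%:E | theta' in S].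

(* Main.v *)
(* Let D = theta - theta*, Psi the Gram matrix and suppose that the noise score
   n^-1 X^T W is at most r / 2 in sup-norm. Minimality confines D to the cone
   |D_{J^c}|_1 <= c0 |D_J|_1, and the first-order conditions give
   |Psi D|_oo <= 3 r / 2. Since Psi is the identity up to off-diagonal entries of
   size mu = 1 / (alpha (1 + 2 c0) s), each coordinate of D is at most
   3 r / 2 + mu |D|_1; summing over J bounds |D_J|_1, hence |D|_1, and feeding this
   back bounds every coordinate.

   The noise score is controlled by Nemirovski's inequality. The potential
   F(z) = (1 + sum_j z_j^(2m))^(1/m) with m of order log M dominates |z|_oo^2, and
   its second derivative along h is O(m |h|_oo^2). Adding one independent centered
   summand at a time, the first-order term integrates to zero, so the expectation of
   F at the full sum is at most 1 + O(m) times the sum of the second moments, and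
   Markov's inequality concludes.

   The event is measurable because its complement is a countable union of sets
   {y | some minimizer lies in the closed set A}, and each of those is a countable
   Boolean combination of projections of closed sets along compact sets. *)
Require Import Defs.
From mathcomp Require Import all_boot all_order all_algebra.
From mathcomp Require Import all_classical all_reals all_analysis.
From mathcomp Require Import measurable_realfun ring lra.
Set Implicit Arguments.
Unset Strict Implicit.
Unset Printing Implicit Defensive.
Import Order.TTheory GRing.Theory Num.Theory.
Import numFieldNormedType.Exports.
Local Open Scope classical_set_scope.
Local Open Scope ring_scope.

(** * A smooth potential dominating the squared sup-norm *)

Lemma is_derive1_chain {R : realType} (f g : R -> R) (x df dg : R) :
  is_derive x (1 : R) g dg -> is_derive (g x) (1 : R) f df ->
  is_derive x (1 : R) (f \o g) (df * dg).
Proof.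
move=> gx fx; apply: DeriveDef.
  apply/derivable1_diffP; apply: differentiable_comp;
    apply/derivable1_diffP; exact: ex_derive.
by rewrite -derive1E derive1_comp ?derive1E ?derive_val//; exact: ex_derive.
Qed.

Section Potential.
Context {R : realType} (M m : nat).
Implicit Types z h : 'I_M -> R.

(** The summand 1 keeps the base of the real power away from 0, so that the potential is
    differentiable everywhere and its gradient may be divided by this base. *)
Definition pow_den z : R := 1 + \sum_(j < M) z j ^+ (2 * m).

Definition potential z : R := pow_den z `^ m%:R^-1.

(** The quotient of [potential z] by [pow_den z] stands for the real power of [pow_den z] with
    exponent 1/m - 1; the factor m of the inner derivative cancels the outer 1/m. *)
Definition potential_grad z (j : 'I_M) : R :=
  2 * potential z * z j ^+ (2 * m).-1 / pow_den z.

Lemma pow_den_ge1 z : 1 <= pow_den z.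
Proof. by rewrite lerDl sumr_ge0// => j _; rewrite exprM exprn_ge0 ?sqr_ge0. Qed.

Lemma pow_den_gt0 z : 0 < pow_den z.
Proof. exact: lt_le_trans (pow_den_ge1 z). Qed.

Lemma potential_gt0 z : 0 < potential z.
Proof. by rewrite powR_gt0 ?pow_den_gt0. Qed.

Hypothesis m_gt0 : (0 < m)%N.

Lemma potentialX z : potential z ^+ m = pow_den z.
Proof.
rewrite -powR_mulrn ?powR_ge0// -powRrM mulVf ?pnatr_eq0 -?lt0n//.
by rewrite powRr1// ltW ?pow_den_gt0.
Qed.

Lemma sqr_le_potential z j : z j ^+ 2 <= potential z.
Proof.
rewrite -(ler_pXn2r m_gt0) ?nnegrE ?sqr_ge0 ?(ltW (potential_gt0 z))//.
rewrite potentialX -exprM /pow_den (bigD1 j)//= addrCA lerDl addr_ge0//.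
by apply: sumr_ge0 => i _; rewrite exprM exprn_ge0 ?sqr_ge0.
Qed.

(** Since z_j^2 <= F, the power z_j^(2m-2) is at most F^(m-1), while the denominator is F^m. This
    linear growth makes the first-order terms integrable later on. *)
Lemma potential_grad_le z j : `|potential_grad z j| <= 2 * `|z j|.
Proof.
have F0 := potential_gt0 z; have D0 := pow_den_gt0 z.
rewrite /potential_grad; have -> : (2 * m).-1 = (2 * m.-1).+1.
  by case: m m_gt0 => // k _; rewrite mulnS.
rewrite normrM normfV [`|pow_den z|]gtr0_norm// ler_pdivrMr//.
rewrite exprS exprM !normrM normr_nat [`|potential z|]gtr0_norm//.
rewrite -!mulrA ler_pM2l// mulrCA ler_wpM2l ?normr_ge0//.
have -> : pow_den z = potential z * potential z ^+ m.-1.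
  by rewrite -exprS prednK// potentialX.
rewrite !normrX.
rewrite ler_wpM2l ?(ltW F0)// lerXn2r ?nnegrE ?exprn_ge0 ?normr_ge0 ?(ltW F0)//.
by rewrite real_normK ?num_real// sqr_le_potential.
Qed.

(* [y ^ (m-1) <= 1 + y ^ m] at [y = 2 z_j^2 / F] replaces Hoelder's inequality. *)
Lemma sum_pow_le_potential z : (M <= 2 ^ m.-1)%N ->
  \sum_(j < M) z j ^+ (2 * m.-1) <= 3 * potential z ^+ m.-1.
Proof.
move=> Mm; have F0 := potential_gt0 z.
have F20 : 0 < potential z / 2 by rewrite divr_gt0.
have pt (j : 'I_M) : z j ^+ (2 * m.-1) <=
    (potential z / 2) ^+ m.-1 + z j ^+ (2 * m) / (potential z / 2).
  rewrite !exprM; set a := z j ^+ 2; set b := potential z / 2.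
  have a0 : 0 <= a by exact: sqr_ge0.
  have [ab|/ltW ba] := leP a b.
    rewrite -[leLHS]addr0 lerD//; first by rewrite lerXn2r ?nnegrE// ltW.
    by apply: divr_ge0; [exact: exprn_ge0|exact: ltW F20].
  rewrite -[leLHS]add0r lerD ?exprn_ge0 ?(ltW F20)// ler_pdivlMr//.
  rewrite -{2}(prednK m_gt0) exprSr; apply: ler_wpM2l => //; exact: exprn_ge0.
apply: (le_trans (ler_sum _ (fun j _ => pt j))).
rewrite big_split/= sumr_const card_ord -mulr_suml.
apply: (@le_trans _ _ (potential z ^+ m.-1 + 2 * potential z ^+ m.-1)); last first.
  by rewrite -[X in X + _]mul1r -mulrDl ler_wpM2r ?exprn_ge0 ?(ltW F0)//; lra.
apply: lerD.
  (* Halving F has produced a factor 2^-(m-1), which absorbs the M equal summands. *)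
  rewrite -[leLHS]mulr_natr exprMn exprVn -mulrA ler_piMr ?exprn_ge0 ?(ltW F0)//.
  by rewrite mulrC ler_pdivrMr ?exprn_gt0// mul1r -natrX ler_nat.
rewrite ler_pdivrMr//.
have -> : 2 * potential z ^+ m.-1 * (potential z / 2) = pow_den z.
  by rewrite -potentialX -{2}(prednK m_gt0) exprSr; field.
by rewrite /pow_den lerDr.
Qed.


Lemma is_derive_pow_den z h (t : R) :
  is_derive t (1 : R) (fun t : R => pow_den (fun j => z j + t * h j))
    ((2 * m)%:R * \sum_(j < M) (z j + t * h j) ^+ (2 * m).-1 * h j).
Proof.
have -> : (fun t : R => pow_den (fun j => z j + t * h j)) =
    cst 1 + \sum_(j < M) (cst (z j) + h j \*: id) ^+ (2 * m).
  apply/funext => u; rewrite /pow_den addrfctE/= fct_sumE; congr (_ + _).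
  by apply: eq_bigr => j _; rewrite /= exprfctE addrfctE/= [u * _]mulrC.
apply: is_derive_eq.
rewrite add0r mulr_sumr; apply: eq_bigr => j _.
by rewrite add0r /GRing.scale/= mulr1 -mulrA [t * _]mulrC.
Qed.

Let line z h (t : R) := fun j => z j + t * h j.

Let slope z h (t : R) := \sum_(j < M) line z h t j ^+ (2 * m).-1 * h j.

Let slopeE z h t : \sum_(j < M) potential_grad (line z h t) j * h j =
  2 * (pow_den (line z h t) `^ (m%:R^-1 - 1) * slope z h t).
Proof.
have D0 := pow_den_gt0 (line z h t).
rewrite powRD; last by rewrite (gt_eqF D0) implybT.
rewrite powR_inv1 ?(ltW D0)//.
rewrite /slope !mulr_sumr; apply: eq_bigr => j _.
by rewrite /potential_grad /potential; ring.
Qed.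

Lemma is_derive_potential z h (t : R) :
  is_derive t (1 : R) (fun t : R => potential (line z h t))
    (\sum_(j < M) potential_grad (line z h t) j * h j).
Proof.
have D0 := pow_den_gt0 (line z h t).
have := is_derive1_chain (is_derive_pow_den z h t) (is_derive1_powR m%:R^-1 D0).
move/is_derive_eq; apply.
rewrite slopeE /slope natrM mulrACA; congr (_ * _).
have m0 : m%:R != 0 :> R by rewrite pnatr_eq0 -lt0n.
by field.
Qed.

Let is_derive_slope z h (t : R) : is_derive t (1 : R) (slope z h)
  ((2 * m).-1%:R * \sum_(j < M) line z h t j ^+ (2 * m.-1) * h j ^+ 2).
Proof.
have -> : slope z h =
    \sum_(j < M) h j \*: (cst (z j) + h j \*: id) ^+ (2 * m).-1.
  apply/funext => u; rewrite /slope fct_sumE.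
  apply: eq_bigr => j _.
  by rewrite /= exprfctE addrfctE/= [h j *: u]mulrC [RHS]mulrC.
apply: is_derive_eq.
rewrite mulr_sumr; apply: eq_bigr => j _.
have -> : (2 * m).-2 = (2 * m.-1)%N by case: m m_gt0 => // k _; rewrite mulnS.
rewrite add0r /line /GRing.scale/= mulr1 [t * _]mulrC; ring.
Qed.

(** With a = 1/m - 1 the slope is 2 D^a B. Differentiating D^a gives a multiple of a B^2, which is
    nonpositive and is dropped. Differentiating B gives 2 (2m-1) D^a Q with Q <= 3 F^(m-1) eta^2,
    and D^a F^(m-1) = 1; hence the constant 2 * 2m * 3 = 12 m. *)
Let potential_second_deriv z h (t eta : R) : (M <= 2 ^ m.-1)%N ->
  (forall j, `|h j| <= eta) ->
  exists2 dd, is_derive t (1 : R)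
    (fun t : R => \sum_(j < M) potential_grad (line z h t) j * h j) dd &
    dd <= 12 * m%:R * eta ^+ 2.
Proof.
move=> Mm heta; have D0 := pow_den_gt0 (line z h t).
set a : R := m%:R^-1 - 1.
have a0 : a <= 0 by rewrite subr_le0 invf_le1 ?ler1n ?ltr0n.
have Pd := is_derive1_chain (is_derive_pow_den z h t)
  (is_derive1_powR a D0).
have Sd := is_derive_slope z h t.
eexists.
  rewrite (_ : (fun t => _) = 2 \*: ((@powR R ^~ a \o
      (fun t : R => pow_den (line z h t))) * slope z h)).
    exact: is_deriveZ.
  by apply/funext => u; rewrite slopeE.
rewrite /GRing.scale/= -/(line z h t) -/(slope z h t).
set D := pow_den _ in D0 *; set Q := \sum_(j < M) _; set B := slope z h t.
have neg : B * (a * D `^ (a - 1) * ((2 * m)%:R * B)) <= 0.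
  rewrite (_ : _ * _ = a * (D `^ (a - 1) * (2 * m)%:R * B ^+ 2)); last by ring.
  apply: mulr_le0_ge0 => //; apply: mulr_ge0; last exact: sqr_ge0.
  by rewrite mulr_ge0 ?powR_ge0 ?ler0n.
have Q0 : 0 <= Q.
  by apply: sumr_ge0 => j _; rewrite mulr_ge0 ?sqr_ge0// exprM exprn_ge0 ?sqr_ge0.
have QE : Q <= 3 * potential (line z h t) ^+ m.-1 * eta ^+ 2.
  apply: (@le_trans _ _
      ((\sum_(j < M) line z h t j ^+ (2 * m.-1)) * eta ^+ 2)).
    rewrite mulr_suml; apply: ler_sum => j _; apply: ler_wpM2l.
      by rewrite exprM exprn_ge0 ?sqr_ge0.
    have eta0 : 0 <= eta := le_trans (normr_ge0 _) (heta j).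
    by rewrite -(real_normK (num_real (h j))) lerXn2r ?nnegrE.
  by rewrite ler_wpM2r ?sqr_ge0// sum_pow_le_potential.
have Da : D `^ a * potential (line z h t) ^+ m.-1 = 1.
  rewrite /a powRD; last by rewrite (gt_eqF D0) implybT.
  rewrite powR_inv1 ?(ltW D0)// mulrAC -/(potential (line z h t)) -exprS.
  by rewrite prednK// potentialX divff// gt_eqF.
apply: (@le_trans _ _ (2 * (D `^ a * ((2 * m).-1%:R * Q)))).
  by rewrite ler_pM2l// gerDl.
apply: (@le_trans _ _ (2 * (D `^ a * ((2 * m)%:R *
    (3 * potential (line z h t) ^+ m.-1 * eta ^+ 2))))).
  rewrite ler_pM2l// ler_wpM2l ?powR_ge0// ler_pM// ler_nat; exact: leq_pred.
rewrite [leLHS](_ : _ = 12 * m%:R * eta ^+ 2 *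
  (D `^ a * potential (line z h t) ^+ m.-1)); last by rewrite natrM; ring.
by rewrite Da mulr1.
Qed.

(** Two mean value steps along the segment from z to z + h: the increment is phi'(c) with 0 < c < 1,
    and phi'(c) - phi'(0) = phi''(u) c, where c is bounded by 1. *)
Lemma potential_smooth z h (eta : R) : (M <= 2 ^ m.-1)%N ->
  (forall j, `|h j| <= eta) ->
  potential (fun j => z j + h j) <=
  potential z + \sum_(j < M) potential_grad z j * h j + 12 * m%:R * eta ^+ 2.
Proof.
move=> Mm heta.
have line0 : line z h 0 = z by apply/funext => j; rewrite /line mul0r addr0.
have line1 : line z h 1 = (fun j => z j + h j).
  by apply/funext => j; rewrite /line mul1r.
have K0 : 0 <= 12 * m%:R * eta ^+ 2 by rewrite mulr_ge0 ?sqr_ge0 ?mulr_ge0 ?ler0n.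
have cvg_der (f df : R -> R) (a b : R) :
    (forall x, is_derive x (1 : R) f (df x)) -> {within `[a, b], continuous f}.
  move=> fdf; apply: derivable_within_continuous => x _; exact: ex_derive.
pose phi' t := \sum_(j < M) potential_grad (line z h t) j * h j.
have phi'E t := is_derive_potential z h t.
have [c cI] := MVT ltr01 (fun x _ => phi'E x) (@cvg_der _ _ 0 1 phi'E).
rewrite line0 line1 subr0 mulr1 => /(canRL (subrK _)) ->.
rewrite addrC -addrA lerD2l -/(phi' c).
have /choice[phi'' phi''P] (t : R) : exists dd : R, is_derive t (1 : R) phi' dd /\
    dd <= 12 * m%:R * eta ^+ 2.
  by have [dd d1 d2] := potential_second_deriv z t Mm heta; exists dd.
have phi''E t := (phi''P t).1.
have /andP[c0 c1] : 0 < c < 1 by move: cI; rewrite in_itv.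
have [u uI] := MVT c0 (fun x _ => phi''E x) (@cvg_der _ _ 0 c phi''E).
rewrite subr0 => /(canRL (subrK _)) ->.
rewrite [leLHS]addrC /phi' line0 lerD2l.
apply: (@le_trans _ _ (12 * m%:R * eta ^+ 2 * c)).
  by rewrite ler_wpM2r ?(phi''P u).2 ?ltW.
by rewrite ler_piMr// ltW.
Qed.

End Potential.

(** * Orthogonality under independence *)

Section Independence.
Context {R : realType} {d : measure_display} {T : measurableType d}.
Context (P : probability T R).

(** The law of [X] under [P] restricted to [A] is [P A] times its law under [P], so both sides are
    integrals of [f] against the same measure on the line. *)
Let integral_indep_ge0 (A : set T) (X : {RV P >-> R}) (f : R -> \bar R) :
  measurable A ->
  (forall B, measurable B -> P (A `&` X @^-1` B) = (P A * P (X @^-1` B))%E) ->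
  measurable_fun [set: R] f -> (forall x, (0 <= f x)%E) ->
  (\int[P]_(w in A) f (X w) = P A * \int[P]_w f (X w))%E.
Proof.
move=> mA ind mf f0.
have mfX : measurable_fun setT (f \o X) by exact: measurableT_comp.
have PA_fin : P A \is a fin_num by exact: fin_num_measure.
have PA0 : 0 <= fine (P A) by rewrite fine_ge0.
transitivity (\int[mrestr P mA]_w (f \o X) w)%E.
  rewrite [RHS](ge0_negligible_integral (measurableC mA) measurableT mfX
    (fun w _ => f0 _)); last by rewrite /= /mrestr setICl measure0.
  rewrite setTD setCK; apply: eq_measure_integral => B mB BA.
  by rewrite /= /mrestr setIidl.
rewrite -(@ge0_integral_pushforward _ _ _ _ _ X _ (mrestr P mA) setT f)//.
rewrite -[in RHS](@ge0_integral_pushforward _ _ _ _ _ X _ P setT f)//.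
rewrite -[P A in RHS]fineK// -[fine (P A)]/((NngNum PA0)%:num).
rewrite -ge0_integral_mscale//.
apply: eq_measure_integral => B mB _.
by rewrite /= /pushforward /mrestr /mscale/= fineK// setIC ind.
Qed.

Lemma integral_indep_eq0 (A : set T) (X : {RV P >-> R}) :
  measurable A ->
  (forall B, measurable B -> P (A `&` X @^-1` B) = (P A * P (X @^-1` B))%E) ->
  P.-integrable setT (EFin \o X) -> (\int[P]_w (X w)%:E = 0)%E ->
  (\int[P]_(w in A) (X w)%:E = 0)%E.
Proof.
move=> mA ind iX X0.
pose p := (@EFin R)^\+%E; pose q := (@EFin R)^\-%E.
have mp : measurable_fun [set: R] p by exact: measurable_funepos.
have mq : measurable_fun [set: R] q by exact: measurable_funeneg.
have ip : (\int[P]_w p (X w) \is a fin_num)%E.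
  by have := integrable_pos_fin_num measurableT iX; rewrite funepos_comp.
have iq : (\int[P]_w q (X w) \is a fin_num)%E.
  by have := integrable_neg_fin_num measurableT iX; rewrite funeneg_comp.
rewrite integralE funepos_comp funeneg_comp.
rewrite (integral_indep_ge0 mA ind mp (funepos_ge0 _)).
rewrite (integral_indep_ge0 mA ind mq (funeneg_ge0 _)).
rewrite -muleBr ?fin_num_measure ?fin_num_adde_defr//.
by move: X0; rewrite integralE funepos_comp funeneg_comp => ->; rewrite mule0.
Qed.

Context {I : finType} (W : I -> {RV P >-> R}).
Hypothesis indepW : mutually_independent W.
Variable k : I.

(** The product formula is used twice: over all indices, with [C] inserted at [k], and over the
    indices other than [k]. *)
Let indep_others (B : I -> set R) (C : set R) :
  (forall i, measurable (B i)) -> measurable C ->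
  let A := \bigcap_(i in [set` ~: [set k]%SET]) W i @^-1` B i in
  P (A `&` W k @^-1` C) = (P A * P (W k @^-1` C))%E.
Proof.
move=> mB mC A; pose B' i := if i == k then C else B i.
have mB' i : measurable (B' i) by rewrite /B'; case: ifP.
have -> : A `&` W k @^-1` C = \bigcap_(i in [set` [set: I]%SET]) W i @^-1` B' i.
  apply/seteqP; split => [w [Aw Cw] i _|w Bw].
    rewrite /= /B'; case: eqP => [->//|/eqP ik]; apply: Aw.
    by rewrite /= !inE.
  split => [i|]; last by have := Bw k; rewrite /= /B' eqxx inE; apply.
  by rewrite /= !inE => ik; have := Bw i; rewrite /= /B' (negbTE ik) inE; apply.
rewrite (indepW _ mB') (indepW _ mB) (bigD1 k) ?inE//= {1}/B' eqxx muleC.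
congr (_ * _)%E; apply: eq_big => [i|i /andP[_ ik]]; first by rewrite !inE.
by rewrite /B' (negbTE ik).
Qed.

Hypothesis integrableW : P.-integrable setT (EFin \o W k).
Hypothesis meanW : (\int[P]_w (W k w)%:E = 0)%E.

(** Setting coordinate [k] to 0 turns any function of the whole family into a function of the
    variables other than [W k]; the parameter [g] leaves room for simple approximations of the
    identity. *)
Let others (g : R -> R) (w : T) (i : I) : R := if i == k then 0 else g (W i w).

Import HBSimple.

(** For simple [g] the vector [others g w] takes finitely many values. On each level set [phi] is
    constant and the level set is independent of [W k], so the integral is a finite sum of zeros,
    whatever the regularity of [phi]. *)
Let simple_others_orthogonal (g : {sfun R >-> R}) (phi : (I -> R) -> R) :
  measurable_fun setT (fun w => (phi (others g w) * W k w)%:E) /\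
  (\int[P]_w (phi (others g w) * W k w)%:E = 0)%E.
Proof.
pose vs : seq R := finmap.enum_fset (fset_set (range g)).
have gvs x : g x \in vs by rewrite /vs in_fset_set// inE; exists x.
(* Values of [g] are replaced by their indices in [vs], so that the level sets are indexed by a
   finite type. The successor in the bound keeps the ordinal type inhabited. *)
pose code w : {ffun I -> 'I_(size vs).+1} :=
  [ffun i => if i == k then ord0 else inord (index (g (W i w)) vs)].
pose decode (f : {ffun I -> 'I_(size vs).+1}) : I -> R :=
  fun i => if i == k then 0 else nth 0 vs (f i).
have codeK w : decode (code w) = others g w.
  apply/funext => i; rewrite /decode /code /others ffunE; case: eqP => // _.
  by rewrite inordK ?nth_index ?gvs// ltnS index_size.
pose A f := [set w | code w = f].
pose B (f : {ffun I -> 'I_(size vs).+1}) i : set R :=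
  [set x | index (g x) vs = f i].
have mB f i : measurable (B f i).
  pose y := nth 0 vs (f i).
  have -> : B f i = if index y vs == f i then g @^-1` [set y] else set0.
    apply/seteqP; split => x; rewrite /B /=.
      by move=> fi; rewrite /y -fi nth_index ?gvs// eqxx.
    by case: eqP => //= yi ->.
  by case: ifP => // _; apply: measurable_funPTI; exact: measurable_set1.
have AE f : A f = if f k == ord0 then
    \bigcap_(i in [set` ~: [set k]%SET]) W i @^-1` B f i else set0.
  apply/seteqP; split => w; rewrite /A /=.
    move=> <-; rewrite ffunE !eqxx => i; rewrite /= !inE => /negbTE ik.
    by rewrite /B /= ffunE ik inordK// ltnS index_size.
  case: eqP => // fk Bw; apply/ffunP => i; rewrite ffunE.
  case: eqP => [->//|/eqP ik]; apply/val_inj => /=.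
  by rewrite inordK ?ltnS ?index_size//; apply: Bw; rewrite /= !inE.
have mA f : measurable (A f).
  rewrite AE; case: ifP => // _; apply: fin_bigcap_measurable => // i _.
  by rewrite -[X in measurable X]setTI; exact: measurable_funP.
have indA f C : measurable C -> P (A f `&` W k @^-1` C) = (P (A f) * P (W k @^-1` C))%E.
  move=> mC; rewrite AE; case: ifP => _; first exact: indep_others.
  by rewrite set0I !measure0 mul0e.
have E : (fun w => (phi (others g w) * W k w)%:E) =
    (fun w => \sum_f ((phi (decode f))%:E * ((EFin \o W k) \_ (A f)) w))%E.
  apply/funext => w; rewrite (bigD1 (code w))//= big1 ?adde0.
    by rewrite patchE mem_set// codeK EFinM.
  move=> f fw; rewrite patchE ifN ?mule0// notin_setE /A /= => fE.
  by rewrite fE eqxx in fw.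
have iA f : P.-integrable setT ((EFin \o W k) \_ (A f)).
  apply: (iffLR (integrable_restrict _ _ _ _)) => //.
  by apply: integrableS integrableW => //; rewrite setTI.
have iA' f : P.-integrable setT
    (fun w => (phi (decode f))%:E * ((EFin \o W k) \_ (A f)) w)%E.
  exact: integrableZl.
rewrite E; split.
  by apply: emeasurable_sum => f; exact: measurable_int (iA' f).
rewrite integral_sum// big1// => f _.
rewrite integralZl//  -integral_mkcond integral_indep_eq0 ?mule0//.
exact: indA.
Qed.

(** Simple functions [g n] converge pointwise to the identity, continuity of [phi] transfers the
    convergence, and C |W_k| dominates. *)
Let orthogonal_bounded (phi : (I -> R) -> R) (C : R) :
  (forall (u : nat -> I -> R) v, (forall i, u n i @[n --> \oo] --> v i) ->
    phi (u n) @[n --> \oo] --> phi v) ->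
  (forall v, `|phi v| <= C) ->
  measurable_fun setT (fun w => (phi (others id w) * W k w)%:E) /\
  (\int[P]_w (phi (others id w) * W k w)%:E = 0)%E.
Proof.
move=> cphi phiC.
have [g gE] := @approximation_sfun _ _ R (@EFin R) setT measurableT
  (@EFin_measurable R setT).
pose f_ n w := (phi (others (g n) w) * W k w)%:E.
have mf_ n : measurable_fun setT (f_ n) := (simple_others_orthogonal (g n) phi).1.
have cvf w : f_ n w @[n --> \oo] --> (phi (others id w) * W k w)%:E.
  apply: cvg_EFin; first exact: nearW.
  apply: cvgMr_tmp; apply: cphi => i; rewrite /others; case: eqP => _.
    exact: cvg_cst.
  exact: fine_cvg (gE (W i w) Logic.I).
have mf : measurable_fun setT (fun w => (phi (others id w) * W k w)%:E).
  apply: (emeasurable_fun_cvg _ _ mf_) => w _; exact: cvf.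
split => //.
have iC : P.-integrable setT (fun w => C%:E * (abse \o (EFin \o W k)) w)%E.
  by apply: integrableZl => //; exact: integrable_abse.
have [] := @dominated_convergence _ _ _ P setT measurableT f_ _ _ mf_ mf _ iC.
- by apply: aeW => w _; exact: cvf.
- apply: aeW => w n _; rewrite /f_ /= lee_fin normrM ler_wpM2r ?normr_ge0//.
move=> _ _; rewrite (_ : [sequence _]_n = cst 0%E); last first.
  by apply/funext => n /=; rewrite (simple_others_orthogonal (g n) phi).2.
move=> /(cvg_unique _ (@cvg_cst _ 0%E _ _ _)) <- //.
Qed.

(* [x / (1 + |x| / n)] is a bounded truncation of [x]. *)
Lemma orthogonal_others (phi : (I -> R) -> R) :
  (forall (u : nat -> I -> R) v, (forall i, u n i @[n --> \oo] --> v i) ->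
    phi (u n) @[n --> \oo] --> phi v) ->
  P.-integrable setT (fun w => (phi (others id w) * W k w)%:E) ->
  (\int[P]_w (phi (others id w) * W k w)%:E = 0)%E.
Proof.
move=> cphi iphi.
pose clip (n : nat) (x : R) := x / (1 + n.+1%:R^-1 * `|x|).
have den0 n (x : R) : 1 <= 1 + n.+1%:R^-1 * `|x| :> R.
  by rewrite lerDl mulr_ge0 ?invr_ge0.
have den_gt0 n (x : R) : 0 < 1 + n.+1%:R^-1 * `|x| :> R.
  by exact: lt_le_trans ltr01 (den0 n x).
have normclip n x : `|clip n x| = `|x| / (1 + n.+1%:R^-1 * `|x|).
  by rewrite /clip normrM normfV (gtr0_norm (den_gt0 _ _)).
have clip_le n x : `|clip n x| <= `|x|.
  by rewrite normclip ler_pdivrMr// ler_peMr.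
have clip_bd n x : `|clip n x| <= n.+1%:R.
  rewrite normclip ler_pdivrMr// mulrDr mulr1 mulrA divff ?pnatr_eq0// mul1r.
  by rewrite lerDr.
have cclip n (u : nat -> I -> R) v : (forall i, u m i @[m --> \oo] --> v i) ->
    clip n (phi (u m)) @[m --> \oo] --> clip n (phi v).
  move=> uv; apply: cvgM; first exact: cphi.
  apply: cvgV; first by rewrite gt_eqF.
  apply: cvgD; first exact: cvg_cst.
  apply: cvgMl_tmp; apply: cvg_norm; exact: cphi.
pose f_ n w := (clip n (phi (others id w)) * W k w)%:E.
have orth n := @orthogonal_bounded (clip n \o phi) n.+1%:R (cclip n)
  (fun v => clip_bd n (phi v)).
have mf_ n : measurable_fun setT (f_ n) := (orth n).1.
have cvf w : f_ n w @[n --> \oo] --> (phi (others id w) * W k w)%:E.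
  apply: cvg_EFin; first exact: nearW.
  apply: cvgMr_tmp; rewrite -[X in _ --> X]mulr1 -[X in _ * X]invr1.
  apply: cvgMl_tmp; apply: cvgV => //.
  rewrite -[X in _ --> X]addr0; apply: cvgD; first exact: cvg_cst.
  rewrite -(mul0r `|phi (others id w)|); apply: cvgMl.
  exact: cvg_harmonic.
have mf : measurable_fun setT (fun w => (phi (others id w) * W k w)%:E).
  exact: measurable_int iphi.
(* Clipping only decreases absolute values, so the limit itself serves as the dominating
   function. *)
have [] := @dominated_convergence _ _ _ P setT measurableT f_ _ _ mf_ mf _
  (integrable_abse iphi).
- by apply: aeW => w _; exact: cvf.
- apply: aeW => w n _; rewrite /f_ /= lee_fin !normrM.
  apply: ler_wpM2r; first exact: normr_ge0.
  rewrite -normrM; exact: clip_le.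
move=> _ _; rewrite (_ : [sequence _]_n = cst 0%E); last first.
  by apply/funext => n /=; rewrite (orth n).2.
move=> /(cvg_unique _ (@cvg_cst _ 0%E _ _ _)) <- //.
Qed.

End Independence.

(** * Nemirovski's inequality *)

Section PotentialRegularity.
Context {R : realType} (M m : nat).

Lemma cvg_pow_den (u : nat -> 'I_M -> R) v :
  (forall j, u n j @[n --> \oo] --> v j) ->
  pow_den m (u n) @[n --> \oo] --> pow_den m v.
Proof.
move=> uv; apply: cvgD; first exact: cvg_cst.
apply: cvg_big => [|j _]; first exact: add_continuous.
apply: (@cvg_comp _ _ _ (u ^~ j) (@GRing.exp R ^~ _) _ _ _ (uv j)).
  exact: exprn_continuous.
Qed.

Lemma cvg_potential (u : nat -> 'I_M -> R) v :
  (forall j, u n j @[n --> \oo] --> v j) ->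
  potential m (u n) @[n --> \oo] --> potential m v.
Proof.
move=> /cvg_pow_den uv.
have dP := is_derive1_powR m%:R^-1 (pow_den_gt0 m v).
have cP : {for pow_den m v, continuous (@powR R ^~ m%:R^-1)}.
  by apply/differentiable_continuous/derivable1_diffP; exact: ex_derive.
exact: (@cvg_comp _ _ _ (fun n => pow_den m (u n)) (@powR R ^~ _) _ _ _ uv cP).
Qed.

(** Sequential continuity is the form in which [orthogonal_others] asks for regularity of [phi]. *)
Lemma cvg_potential_grad (u : nat -> 'I_M -> R) v j :
  (forall j, u n j @[n --> \oo] --> v j) ->
  potential_grad m (u n) j @[n --> \oo] --> potential_grad m v j.
Proof.
move=> uv; apply: cvgM; first apply: cvgM.
- by apply: cvgMl_tmp; exact: cvg_potential.
- apply: (@cvg_comp _ _ _ (u ^~ j) (@GRing.exp R ^~ _) _ _ _ (uv j)).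
  exact: exprn_continuous.
- by apply: cvgV; [rewrite gt_eqF ?pow_den_gt0|exact: cvg_pow_den].
Qed.

Context {d : measure_display} {T : measurableType d}.
Variable z : T -> 'I_M -> R.
Hypothesis mz : forall j, measurable_fun setT (z ^~ j).

Lemma measurable_pow_den : measurable_fun setT (fun w => pow_den m (z w)).
Proof.
by apply: measurable_funD => //; apply: measurable_sum => j; exact: measurable_funX.
Qed.

Lemma measurable_potential : measurable_fun setT (fun w => potential m (z w)).
Proof. exact: measurableT_comp (measurable_powR _) measurable_pow_den. Qed.

Lemma measurable_potential_grad j :
  measurable_fun setT (fun w => potential_grad m (z w) j).
Proof.
rewrite (_ : (fun w => _) = (fun w => 2 * potential m (z w) * z w j ^+ (2 * m).-1 *
    pow_den m (z w) `^ (-1))).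
  apply: measurable_funM; last first.
    exact: measurableT_comp (measurable_powR _) measurable_pow_den.
  apply: measurable_funM; last exact: measurable_funX.
  by apply: measurable_funM => //; exact: measurable_potential.
by apply/funext => w; rewrite powR_inv1 ?ltW ?pow_den_gt0.
Qed.

End PotentialRegularity.

(** * Moment bound for the potential of a weighted sum, and its tail *)

Section Nemirovski.
Context {R : realType} {d : measure_display} {T : measurableType d}.
Context (P : probability T R) (n M m : nat) (W : 'I_n -> {RV P >-> R}).
Context (x : 'I_n -> 'I_M -> R) (eta : 'I_n -> R) (sigma : R).
Hypotheses (m_gt0 : (0 < m)%N) (Mm : (M <= 2 ^ m.-1)%N).
Hypothesis indepW : mutually_independent W.
Hypothesis meanW : forall i, (\int[P]_w (W i w)%:E = 0)%E.
Hypothesis varW : forall i, (\int[P]_w (W i w ^+ 2)%:E <= (sigma ^+ 2)%:E)%E.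
Hypothesis x_le : forall i j, `|x i j| <= eta i.

Let integrable_sqr i : P.-integrable setT (fun w => (W i w ^+ 2)%:E).
Proof.
apply/integrableP; split.
  by apply/measurable_EFinP; exact: measurable_funX.
under eq_integral do rewrite gee0_abs ?lee_fin ?sqr_ge0//.
by rewrite (le_lt_trans (varW i))// ltry.
Qed.

Let integrable_mul i j : P.-integrable setT (fun w => (W i w * W j w)%:E).
Proof.
apply: (le_integrable _ _ _ (integrableD _ (integrable_sqr i) (integrable_sqr j))) => //.
  by apply/measurable_EFinP; exact: measurable_funM.
move=> w _; rewrite /= lee_fin [leRHS]ger0_norm ?addr_ge0 ?sqr_ge0//.
rewrite normrM -!(real_normK (num_real (W _ w))).
have := sqr_ge0 (`|W i w| - `|W j w|).
have := mulr_ge0 (normr_ge0 (W i w)) (normr_ge0 (W j w)).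
by rewrite sqrrB; lra.
Qed.

Let integrable1 i : P.-integrable setT (EFin \o W i).
Proof.
apply: (le_integrable _ _ _ (integrableD _ (integrable_sqr i)
  (finite_measure_integrable_cst P 1 measurableT))) => //.
  exact/measurable_EFinP.
move=> w _; rewrite /= lee_fin [leRHS]ger0_norm ?addr_ge0 ?sqr_ge0//.
rewrite -(real_normK (num_real (W _ w))).
have := sqr_ge0 (`|W i w| - 1); have := normr_ge0 (W i w).
by rewrite sqrrB; lra.
Qed.

Let S (k : nat) (w : T) (j : 'I_M) : R := \sum_(i < n | (i < k)%N) x i j * W i w.

Let measurable_S k j : measurable_fun setT (S k ^~ j).
Proof.
rewrite /S; under eq_fun do rewrite big_mkcond/=.
by apply: measurable_sum => i /=; case: (i < k)%N => //; exact: measurable_funM.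
Qed.

Let SS (k : 'I_n) w : S k.+1 w = (fun j => S k w j + x k j * W k w).
Proof.
apply/funext => j; rewrite /S [LHS](bigD1 k)//= addrC; congr (_ + _).
by apply: eq_bigl => i; rewrite ltnS andbC ltn_neqAle.
Qed.

Let integrable_S_mul (k : 'I_n) j : P.-integrable setT (fun w => (S k w j * W k w)%:E).
Proof.
rewrite [X in P.-integrable _ X](_ : _ = (fun w => \sum_(i < n | (i < k)%N)
    (x i j)%:E * (W i w * W k w)%:E)%E).
  by apply: integrable_sum => // i _; exact: integrableZl.
apply/funext => w; rewrite /S mulr_suml -sumEFin; apply: eq_bigr => i _.
by rewrite -mulrA EFinM.
Qed.

(** The gradient is at most 2 |S_k,j|, and S_k,j W_k is a combination of products W_i W_k,
    integrable because the squares are. *)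
Let integrable_grad (k : 'I_n) j :
  P.-integrable setT (fun w => (potential_grad m (S k w) j * W k w)%:E).
Proof.
apply: (le_integrable _ _ _ (integrableZl _ 2 (integrable_S_mul k j))) => //.
  apply/measurable_EFinP; apply: measurable_funM => //.
  by apply: measurable_potential_grad => i; exact: measurable_S.
move=> w _; rewrite /= lee_fin (normrM (potential_grad m (S k w) j)) (normrM 2).
  rewrite (normrM (S k w j)) normr_nat mulrA.
by apply: ler_wpM2r; [exact: normr_ge0|exact: (potential_grad_le m_gt0)].
Qed.

Let grad_orthogonal (k : 'I_n) j :
  (\int[P]_w (potential_grad m (S k w) j * W k w)%:E = 0)%E.
Proof.
pose phi (v : 'I_n -> R) :=
  potential_grad m (fun j => \sum_(i < n | (i < k)%N) x i j * v i) j.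
(* The sum S_k involves only indices below [k], so replacing coordinate [k] by 0 does not affect
   it. *)
have E w : potential_grad m (S k w) j =
    phi (fun i => if i == k then 0 else id (W i w)).
  congr (potential_grad m _ j); apply/funext => l; apply: eq_bigr => i ik.
  by rewrite ifN// neq_ltn ik.
under eq_integral do rewrite E.
apply: (orthogonal_others indepW (integrable1 k) (meanW k)).
  move=> u v uv; apply: cvg_potential_grad => l.
  apply: cvg_big => [|i _]; first exact: add_continuous.
  exact: cvgMl_tmp.
have := integrable_grad k j.
by under eq_fun do rewrite E.
Qed.

(** The leading 1 is the potential at 0. Integrability is carried along the induction because
    splitting the integral of the one-step majorant [G] requires it. *)
Lemma potential_moment (k : nat) : (k <= n)%N ->
  P.-integrable setT (fun w => (potential m (S k w))%:E) /\
  (\int[P]_w (potential m (S k w))%:E <=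
   (1 + 12 * m%:R * sigma ^+ 2 * \sum_(i < n | (i < k)%N) eta i ^+ 2)%:E)%E.
Proof.
elim: k => [_|k IH kn].
  have S0 : (fun w => (potential m (S 0 w))%:E) = cst 1%E.
    apply/funext => w; rewrite /potential /pow_den big1 ?addr0 ?powR1//.
    by move=> j _; rewrite /S big_pred0// expr0n muln_eq0/= eqn0Ngt m_gt0.
  rewrite S0; split; first exact: finite_measure_integrable_cst.
  have P1 : P setT = 1%E by exact: probability_setT.
  by rewrite integral_cst// mul1e [X in (X <= _)%E]P1 big_pred0// mulr0 addr0.
have [iS eS] := IH (ltnW kn); pose k' := Ordinal kn.
pose G w : \bar R := ((potential m (S k w))%:E +
  \sum_(j < M) (x k' j)%:E * (potential_grad m (S k' w) j * W k' w)%:E +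
  (12 * m%:R * eta k' ^+ 2)%:E * (W k' w ^+ 2)%:E)%E.
have le_G w : ((potential m (S k.+1 w))%:E <= G w)%E.
  rewrite /G -EFinM; under eq_bigr do rewrite -EFinM.
  rewrite sumEFin -!EFinD lee_fin -[k.+1]/(k'.+1) SS.
  have h_le j : `|x k' j * W k' w| <= eta k' * `|W k' w|.
    by rewrite normrM ler_wpM2r.
  have := potential_smooth m_gt0 (S k' w) Mm h_le.
  rewrite exprMn real_normK ?num_real// !mulrA => /le_trans; apply.
  rewrite lerD2r lerD2l le_eqVlt; apply/orP; left; apply/eqP.
  by apply: eq_bigr => j _; ring.
have iG1 : P.-integrable setT (fun w =>
    \sum_(j < M) (x k' j)%:E * (potential_grad m (S k' w) j * W k' w)%:E)%E.
  by apply: integrable_sum => // j _; exact: integrableZl.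
have iG2 : P.-integrable setT (fun w =>
    (12 * m%:R * eta k' ^+ 2)%:E * (W k' w ^+ 2)%:E)%E by exact: integrableZl.
have iG : P.-integrable setT G by apply: integrableD => //; exact: integrableD.
have iS' : P.-integrable setT (fun w => (potential m (S k.+1 w))%:E).
  apply: (le_integrable _ _ _ iG) => //.
    apply/measurable_EFinP; apply: measurable_potential; exact: measurable_S.
  move=> w _; rewrite gee0_abs ?lee_fin ?(ltW (potential_gt0 _ _))//.
  exact: le_trans (le_G w) (lee_abs _).
split => //.
have -> : (\sum_(i < n | (i < k.+1)%N) eta i ^+ 2 =
    \sum_(i < n | (i < k)%N) eta i ^+ 2 + eta k' ^+ 2).
  rewrite (bigD1 k')//= addrC; congr (_ + _).
  by apply: eq_bigl => i; rewrite ltnS andbC ltn_neqAle.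
apply: (@le_trans _ _ (\int[P]_w G w)%E).
  by apply: le_integral => // w _; exact: le_G.
rewrite integralD//; last exact: integrableD.
rewrite integralD// integral_sum//; last by move=> j; exact: integrableZl.
rewrite big1 ?adde0; last first.
  by move=> j _; rewrite integralZl// grad_orthogonal mule0.
rewrite integralZl// mulrDr addrA EFinD leeD//.
rewrite [X in (_ <= X%:E)%E]mulrAC [X in (_ <= X)%E]EFinM lee_wpmul2l//.
by rewrite lee_fin mulr_ge0 ?sqr_ge0// mulr_ge0 ?ler0n.
Qed.

(** Markov's inequality for the potential; a single event serves all coordinates because the
    potential dominates every squared coordinate. *)
Lemma sum_sqr_tail (t : R) : 0 < t ->
  exists2 A, measurable A &
  (P (~` A) <= ((1 + 12 * m%:R * sigma ^+ 2 * \sum_(i < n) eta i ^+ 2) / t)%:E)%E /\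
  forall w, A w -> forall j, (\sum_(i < n) x i j * W i w) ^+ 2 <= t.
Proof.
move=> t0; set K := 1 + _; have [iS eS] := potential_moment (leqnn n).
pose B := [set w | t <= potential m (S n w)].
have mB : measurable B.
  rewrite -[B]setTI; apply: measurable_fun_le => //.
  by apply: measurable_potential => j; exact: measurable_S.
exists (~` B); first exact: measurableC.
split; last first.
  move=> w Bw j; apply: (@le_trans _ _ (potential m (S n w))).
    rewrite (eq_bigl (fun i : 'I_n => (i < n)%N)) => [|i]; last by rewrite ltn_ord.
    exact: (sqr_le_potential m_gt0 (S n w) j).
  by move/negP: Bw; rewrite -ltNge => /ltW.
rewrite setCK -[P B]fineK ?fin_num_measure// lee_fin ler_pdivlMr// mulrC.
rewrite -lee_fin EFinM fineK ?fin_num_measure//.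
rewrite -[leLHS]/(t%:E * P B)%E -(setIT B) -integral_indic//.
rewrite -integralZl//; last exact: integrable_indic.
apply: (@le_trans _ _ (\int[P]_w (potential m (S n w))%:E)%E).
  apply: le_integral => //; first by apply: integrableZl => //; exact: integrable_indic.
  move=> w _; rewrite -EFinM lee_fin indicE.
  have [|_] := boolP (w \in B); first by rewrite inE mulr1.
  by rewrite mulr0 ltW ?potential_gt0.
apply: le_trans eS _; rewrite lee_fin (eq_bigl predT)// => i.
by rewrite ltn_ord.
Qed.

End Nemirovski.

(** * Deterministic error bound *)

Section Norms.
Context {R : realType}.

Lemma lp_norm1E d (z : 'cV[R]_d) : lp_norm 1 z = \sum_j `|z j 0|.
Proof.
rewrite /lp_norm invr1 powRr1; last by apply: sumr_ge0 => j _; exact: powR_ge0.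
by apply: eq_bigr => j _; rewrite powRr1.
Qed.

Lemma lp_norm2_sqr d (z : 'cV[R]_d) : lp_norm 2 z ^+ 2 = \sum_j z j 0 ^+ 2.
Proof.
have E : \sum_j `|z j 0| `^ 2 = \sum_j z j 0 ^+ 2.
  by apply: eq_bigr => j _; rewrite powR_mulrn// real_normK ?num_real.
rewrite /lp_norm E powR12_sqrt; last by apply: sumr_ge0 => j _; exact: sqr_ge0.
by rewrite sqr_sqrtr//; apply: sumr_ge0 => j _; exact: sqr_ge0.
Qed.

Lemma mx_norm_entry_le m n (A : 'M[R]_(m, n)) i j : `|A i j| <= `|A|.
Proof.
rewrite [leRHS]mx_normrE.
exact: (le_bigmax _ (fun ij : 'I_m * 'I_n => `|A ij.1 ij.2|) (i, j)).
Qed.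

Lemma mx_norm_le m n (A : 'M[R]_(m, n)) (r : R) : 0 <= r ->
  (forall i j, `|A i j| <= r) -> `|A| <= r.
Proof.
move=> r0 h; rewrite [leLHS]mx_normrE.
by apply/bigmax_leP; split => // -[i j] _; exact: h.
Qed.

End Norms.

(** * Sup-norm control on the cone under small coherence *)

Section ConeBound.
Context {R : realType} (M : nat) (Psi : 'M[R]_M) (J : {set 'I_M}) (s : nat).
Context (alpha c b : R) (D : 'cV[R]_M).
Hypotheses (alpha_gt1 : 1 < alpha) (s_gt0 : (0 < s)%N) (c_ge0 : 0 <= c).
Hypothesis diag : forall j, Psi j j = 1.
Hypothesis offdiag :
  forall i j, i != j -> `|Psi i j| <= 1 / (alpha * (1 + 2 * c) * s%:R).
Hypothesis card_J : (#|J| <= s)%N.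
Hypothesis cone : \sum_(j | j \notin J) `|D j 0| <= c * \sum_(j in J) `|D j 0|.
Hypothesis Psi_le : forall j, `|(Psi *m D) j 0| <= b.

Lemma cone_sup_bound j :
  `|D j 0| <= b * (1 + (1 + c) ^+ 2 / ((1 + 2 * c) * (alpha - 1))).
Proof.
move: offdiag cone; set mu := 1 / _; set a := \sum_(j in J) `|D j 0| => off cone_a.
have s0 : 0 < s%:R :> R by rewrite ltr0n.
have al1 := alpha_gt1; have c0 := c_ge0.
have al0 : 0 < alpha by lra.
have den0 : 0 < alpha * (1 + 2 * c) * s%:R by rewrite !mulr_gt0//; lra.
have mu0 : 0 <= mu by rewrite divr_ge0// ltW.
have a0 : 0 <= a by apply: sumr_ge0.
have b0 : 0 <= b := le_trans (normr_ge0 _) (Psi_le j).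
have D_le i : `|D i 0| <= b + mu * ((1 + c) * a).
  have -> : D i 0 = (Psi *m D) i 0 - \sum_(j | j != i) Psi i j * D j 0.
    by rewrite mxE (bigD1 i)//= diag mul1r addrK.
  rewrite (le_trans (ler_normB _ _))// lerD//.
  rewrite (le_trans (ler_norm_sum _ _ _))//.
  apply: (@le_trans _ _ (\sum_j mu * `|D j 0|)).
    rewrite [leRHS](bigD1 i)//= -[leLHS]add0r; apply: lerD; first exact: mulr_ge0.
    apply: ler_sum => k ki; rewrite normrM ler_wpM2r// off//.
    by rewrite eq_sym.
  rewrite -mulr_sumr ler_wpM2l// (bigID (mem J))/= mulrDl mul1r.
  by rewrite lerD2l.
have a_le : a <= s%:R * (b + mu * ((1 + c) * a)).
  apply: (le_trans (ler_sum _ (fun i _ => D_le i))).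
  rewrite sumr_const -[leLHS]mulr_natl ler_wpM2r ?ler_nat//.
  by apply: addr_ge0 => //; apply: mulr_ge0 => //; apply: mulr_ge0 => //; lra.
have muE : mu * (alpha * (1 + 2 * c) * s%:R) = 1.
  by rewrite /mu mul1r mulVf ?gt_eqF.
(* Multiplying [a_le] by mu alpha (1 + 2c) turns the factor s into 1, by [muE]. Then mu (1 + c) a <=
   mu (1 + 2c) a is moved to the left, which leaves alpha - 1. *)
have mu_a : mu * a * ((1 + 2 * c) * (alpha - 1)) <= b.
  have k0 : 0 <= mu * (alpha * (1 + 2 * c)).
    by apply: mulr_ge0 => //; apply: mulr_ge0; lra.
  have := ler_wpM2l k0 a_le.
  rewrite [X in _ <= X](_ : _ = mu * (alpha * (1 + 2 * c) * s%:R) *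
    (b + mu * ((1 + c) * a))); last by ring.
  rewrite muE mul1r.
  have mua0 : 0 <= mu * a by exact: mulr_ge0.
  have muac0 : 0 <= mu * a * c by exact: mulr_ge0.
  by move: mua0 muac0; nra.
apply: (le_trans (D_le j)); rewrite mulrDr mulr1 lerD2l.
rewrite mulrA ler_pdivlMr; last by rewrite mulr_gt0//; lra.
apply: (@le_trans _ _ ((1 + c) * b)).
  rewrite [leLHS](_ : _ = (1 + c) * (mu * a * ((1 + 2 * c) * (alpha - 1)))).
    by rewrite ler_wpM2l//; lra.
  by ring.
(* The factor obtained is 1 + c; it is enlarged to its square to match the form of [c2]. *)
rewrite mulrC ler_wpM2l// expr2 ler_peMr//; lra.
Qed.

End ConeBound.

(** * Consequences of minimality for the two estimators *)

Section SolutionError.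
Context {R : realType} (n M : nat) (X : 'M[R]_(n, M)).
Implicit Types (theta thetastar : 'cV[R]_M) (y : 'cV[R]_n).

Let score y : 'cV[R]_M := n%:R^-1 *: (X^T *m y).

Let scoreE y j : score y j 0 = n%:R^-1 * \sum_i X i j * y i 0.
Proof. by rewrite /score !mxE; congr (_ * _); apply: eq_bigr => i _; rewrite mxE. Qed.

Let l1 (theta : 'cV[R]_M) : R := \sum_j `|theta j 0|.

Let lasso_objective (r : R) y theta : R :=
  n%:R^-1 * \sum_i (y - X *m theta) i 0 ^+ 2 + 2 * r * l1 theta.

Let lasso_objectiveE r y theta :
  n%:R^-1 * lp_norm 2 (y - X *m theta) ^+ 2 + 2 * r * lp_norm 1 theta =
  lasso_objective r y theta.
Proof.
by congr (_ * _ + _ * _); [exact: lp_norm2_sqr|exact: lp_norm1E].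
Qed.

Let solutions_lasso r y theta : solutions Lasso X r y theta ->
  forall v, lasso_objective r y theta <= lasso_objective r y v.
Proof.
by move=> [_ theta_min] v; rewrite -!lasso_objectiveE; exact: theta_min.
Qed.

Let solutions_dantzig r y theta : solutions Dantzig X r y theta ->
  `|score (y - X *m theta)| <= r /\
  forall v, `|score (y - X *m v)| <= r -> l1 theta <= l1 v.
Proof.
move=> [feas theta_min]; split => // v vr; have := theta_min v vr.
by rewrite (lp_norm1E theta) (lp_norm1E v).
Qed.

(** Moving coordinate j alone by t changes the objective by at most t^2 - 2ta + 2r|t|, where a is
    the score and the coefficient of t^2 is the diagonal Gram entry 1. If |a| > r, the choice t =
    sgn(a) (|a| - r) gives -(|a| - r)^2 < 0, against minimality. *)
Lemma lasso_score_le (r : R) y theta : 0 <= r ->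
  (forall j, gram X j j = 1) -> solutions Lasso X r y theta ->
  `|score (y - X *m theta)| <= r.
Proof.
move=> r0 diag /solutions_lasso theta_min; apply: mx_norm_le => // j k; rewrite ord1 {k}.
set u := y - X *m theta; set a := score u j 0.
have step (t : R) : 0 <= t ^+ 2 - 2 * t * a + 2 * r * `|t|.
  have := theta_min (theta + t *: delta_mx j 0).
  rewrite /lasso_objective mulmxDr opprD addrA -/u.
  set u' := u - _.
  have u'E i : u' i 0 = u i 0 - t * X i j.
    by rewrite /u' -scalemxAr -colE !mxE.
  have -> : \sum_i u' i 0 ^+ 2 =
      \sum_i u i 0 ^+ 2 - 2 * t * (\sum_i X i j * u i 0) + t ^+ 2 * \sum_i X i j * X i j.
    rewrite !mulr_sumr -sumrB -big_split/=; apply: eq_bigr => i _.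
    by rewrite u'E; ring.
  have diagE : n%:R^-1 * \sum_i X i j * X i j = 1.
    rewrite -[RHS](diag j) /gram !mxE; congr (_ * _).
    by apply: eq_bigr => i _; rewrite !mxE.
  have l1_le : l1 (theta + t *: delta_mx j 0) <= l1 theta + `|t|.
    rewrite /l1 (bigD1 j)//= [in leRHS](bigD1 j)//= -addrA [X in _ <= _ + X]addrC addrA.
    apply: lerD.
      by rewrite !mxE !eqxx mulr1 ler_normD.
    rewrite le_eqVlt; apply/orP; left; apply/eqP; apply: eq_bigr => k kj.
    by rewrite !mxE (negbTE kj) mulr0 addr0.
  have l1r := ler_wpM2l (mulr_ge0 (ler0n R 2) r0) l1_le.
  have aE : a = n%:R^-1 * \sum_i X i j * u i 0 by exact: scoreE.
  rewrite !mulrDr mulrN (mulrCA _ (2 * t)) -aE (mulrCA _ (t ^+ 2)) diagE mulr1.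
  by move: l1r; rewrite !mulrDr; lra.
rewrite leNgt; apply/negP => ra.
have := step ((`|a| - r) * Num.sg a).
have sg1 : Num.sg a * Num.sg a = 1.
  by rewrite -expr2 sqr_sg -normr_gt0 (le_lt_trans r0).
rewrite normrM (ger0_norm (_ : 0 <= `|a| - r)); last by rewrite subr_ge0 ltW.
have -> : `|Num.sg a| = 1 by rewrite normr_sg -normr_gt0 (le_lt_trans r0).
have : (`|a| - r) * Num.sg a * a = (`|a| - r) * `|a|.
  by rewrite -mulrA -normrEsg.
have : ((`|a| - r) * Num.sg a) ^+ 2 = (`|a| - r) ^+ 2.
  by rewrite exprMn [Num.sg a ^+ 2]expr2 sg1 mulr1.
move=> -> E; rewrite -[2 * _ * a]mulrA E mulr1.
have ra' : 0 < `|a| - r by rewrite subr_gt0.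
have : 0 < (`|a| - r) ^+ 2 by rewrite exprn_gt0.
by rewrite !expr2; lra.
Qed.

(** Off the support [thetastar] vanishes and the terms agree; on the support this is the reverse
    triangle inequality. *)
Let l1_split theta thetastar :
  \sum_(j | j \notin support_set thetastar) `|(theta - thetastar) j 0| -
  \sum_(j in support_set thetastar) `|(theta - thetastar) j 0| <=
  l1 theta - l1 thetastar.
Proof.
set J := support_set _; rewrite /l1 -sumrB [leRHS](bigID (mem J))/= [leRHS]addrC.
apply: lerD; last first.
  by rewrite -sumrN; apply: ler_sum => j _; rewrite !mxE lerNl opprB distrC lerB_dist.
apply: ler_sum => j; rewrite inE negbK => /eqP j0.
by rewrite !mxE j0 normr0 !subr0.
Qed.

(** For the Lasso, comparing objectives at [theta] and [thetastar] and dropping the square of X D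
    leaves 2r (|D_{J^c}|_1 - |D_J|_1) <= r |D|_1, whence the constant 3. For Dantzig, [thetastar] is
    feasible because r / 2 <= r, so |theta|_1 <= |thetastar|_1 and the constant is 1. *)
Lemma solutions_cone (r : R) e y thetastar theta : 0 < r ->
  `|score (y - X *m thetastar)| <= r / 2 -> solutions e X r y theta ->
  \sum_(j | j \notin support_set thetastar) `|(theta - thetastar) j 0| <=
  c0 R e * \sum_(j in support_set thetastar) `|(theta - thetastar) j 0|.
Proof.
move=> r0 w_le sol; have := l1_split theta thetastar; set J := support_set _.
set D := theta - thetastar; set w := y - X *m thetastar in w_le *.
case: e sol => [/solutions_lasso theta_min|/solutions_dantzig[_ theta_min]] /=.
  have := theta_min thetastar; rewrite /lasso_objective -/w.
  have uE : y - X *m theta = w - X *m D.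
    by rewrite /w /D mulmxBr opprB addrA subrK.
  have sq : \sum_i w i 0 ^+ 2 - 2 * \sum_i w i 0 * (X *m D) i 0 <=
      \sum_i (y - X *m theta) i 0 ^+ 2.
    rewrite mulr_sumr -sumrB; apply: ler_sum => i _.
    have -> : (y - X *m theta) i 0 = w i 0 - (X *m D) i 0 by rewrite uE !mxE.
    rewrite -subr_ge0.
    set p := (X *m D) i 0; set q := w i 0.
    by rewrite (_ : _ - _ = p ^+ 2) ?sqr_ge0//; ring.
  have cross : n%:R^-1 * \sum_i w i 0 * (X *m D) i 0 <= r / 2 * \sum_j `|D j 0|.
    have -> : n%:R^-1 * \sum_i w i 0 * (X *m D) i 0 = \sum_j score w j 0 * D j 0.
      under [RHS]eq_bigr do rewrite scoreE -mulrA mulr_suml.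
      rewrite -mulr_sumr exchange_big/=; congr (_ * _); apply: eq_bigr => i _.
      by rewrite [(X *m D) i 0]mxE mulr_sumr; apply: eq_bigr => j _; ring.
    rewrite mulr_sumr; apply: ler_sum => j _; apply: le_trans (ler_norm _) _.
    by rewrite normrM ler_wpM2r// (le_trans (mx_norm_entry_le _ _ _)).
  have n0 : 0 <= n%:R^-1 :> R by rewrite invr_ge0.
  have := ler_wpM2l n0 sq; rewrite mulrBr mulrCA.
  rewrite (bigID (mem J) predT (fun j => `|D j 0|))/= in cross.
  move: cross; set A := \sum_(j in J) _; set B := \sum_(j | j \notin J) _.
  set p := n%:R^-1 * _; set q := n%:R^-1 * _; set q' := n%:R^-1 * _.
  set t := l1 theta; set t' := l1 thetastar => cross h1 h2 h3.
  have h3r := ler_wpM2l (ltW r0) h3.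
  have : r * B <= r * (3 * A).
    move: cross h1 h2 h3r; rewrite !mulrDr !mulrN => cross h1 h2 h3r.
    by lra.
  by rewrite ler_pM2l.
move=> h; rewrite mul1r -subr_le0; apply: (le_trans h).
rewrite subr_le0; apply: theta_min; apply: (le_trans w_le).
by rewrite ler_pdivrMr// ler_peMr ?ler1n// ltW.
Qed.

Lemma solutions_score_le (r : R) e y theta : 0 <= r ->
  (forall j, gram X j j = 1) -> solutions e X r y theta ->
  `|score (y - X *m theta)| <= r.
Proof.
by case: e => r0 diag; [exact: lasso_score_le|case/solutions_dantzig].
Qed.

Lemma solution_error e (r alpha : R) (s : nat) thetastar theta (w : 'cV[R]_n) :
  0 < r -> (0 < s)%N -> 1 < alpha -> (forall j, gram X j j = 1) ->
  \big[Num.max/0]_(ij : 'I_M * 'I_M | ij.1 != ij.2) `|gram X ij.1 ij.2|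
    <= 1 / (alpha * (1 + 2 * c0 R e) * s%:R) ->
  (sparsity thetastar <= s)%N ->
  `|n%:R^-1 *: (X^T *m w)| <= r / 2 ->
  solutions e X r (X *m thetastar + w) theta ->
  `|theta - thetastar| <= c2 e alpha * r.
Proof.
move=> r0 s0 al diag off sparse w_le sol.
have wE : X *m thetastar + w - X *m thetastar = w by rewrite addrC addKr.
have c0_ge0 : 0 <= c0 R e by case: (e) => /=; lra.
have w_le' : `|score (X *m thetastar + w - X *m thetastar)| <= r / 2 by rewrite wE.
have cone := solutions_cone r0 w_le' sol.
have score_le := solutions_score_le (ltW r0) diag sol.
have off' i j : i != j -> `|gram X i j| <= 1 / (alpha * (1 + 2 * c0 R e) * s%:R).
  move=> ij; apply: le_trans off.
  exact: (@le_bigmax_cond _ _ _ 0 (i, j) (fun ij => ij.1 != ij.2)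
    (fun ij => `|gram X ij.1 ij.2|)).
(* Psi D is the score of the noise minus the score of the residual, so the bound is r / 2 + r; this
   is the factor 3 / 2 in [c2]. *)
have Psi_le j : `|(gram X *m (theta - thetastar)) j 0| <= 3 / 2 * r.
  have -> : gram X *m (theta - thetastar) =
      score w - score (X *m thetastar + w - X *m theta).
    rewrite /score -scalerBr -mulmxBr /gram -scalemxAl -mulmxA.
    congr (_ *: (_ *m _)); rewrite mulmxBr opprB addrCA; congr (_ + _).
    by rewrite opprD addrCA subrr addr0.
  rewrite !mxE; apply: le_trans (ler_normB _ _) _.
  have h1 : `|score w j 0| <= r / 2.
    exact: le_trans (mx_norm_entry_le _ _ _) w_le.
  have h2 : `|score (X *m thetastar + w - X *m theta) j 0| <= r.
    exact: le_trans (mx_norm_entry_le _ _ _) score_le.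
  by move: h1 h2; rewrite !mxE; lra.
apply: mx_norm_le => [|j k]; last first.
  rewrite ord1 (le_trans (cone_sup_bound al s0 c0_ge0 diag off' sparse cone Psi_le j))//.
  by rewrite /c2 le_eqVlt mulrAC eqxx.
rewrite /c2 !mulr_ge0// ?(ltW r0)// addr_ge0// divr_ge0 ?sqr_ge0// mulr_ge0//; lra.
Qed.

End SolutionError.

(** * Measurability of the error event *)

(** Tube lemma: for y outside the projection, each point of [K] has a product neighbourhood avoiding
    [C], and compactness yields one neighbourhood of y good for all of [K]. *)
Lemma closed_proj {U V : topologicalType} (C : set (U * V)) (K : set V) :
  closed C -> compact K -> closed [set y | exists2 v, K v & C (y, v)].
Proof.
move=> cC /compact_near_coveringP cK; rewrite -openC openE => y yK.
have : \forall y' \near y, K `<=` (fun v => ~ C (y', v)).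
  apply: cK => v Kv.
  have : nbhs (y, v) (~` C).
    apply: open_nbhs_nbhs; split; first by rewrite openC.
    by move=> Cyv; apply: yK; exists v.
  move=> [[B1 B2] /= [nB1 nB2] BC]; exists (B2, B1) => //= -[v' y'] /= [Bv By].
  exact: (BC (y', v')).
by apply: filterS => y' h [v Kv]; exact: h.
Qed.

(** * Compact balls and closed sets of column vectors *)

Section ColumnTopology.
Context {R : realType}.

(** Compactness of closed bounded sets of rows is carried over by transposition, an isometry for the
    sup-norm. *)
Lemma compact_cV_ball (M : nat) (B : R) : compact [set v : 'cV[R]_M | `|v| <= B].
Proof.
have normT m n (A : 'M[R]_(m, n)) : `|A^T| = `|A|.
  apply/eqP; rewrite eq_le; apply/andP; split; apply: mx_norm_le => // i j.
    by rewrite mxE mx_norm_entry_le.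
  by have -> : A i j = A^T j i; [rewrite mxE|exact: mx_norm_entry_le].
have -> : [set v : 'cV[R]_M | `|v| <= B] = trmx @` [set v : 'rV[R]_M | `|v| <= B].
  apply/seteqP; split => [v vB|_ [v vB <-]]; last by rewrite /= normT.
  by exists v^T; rewrite ?trmxK//= normT.
apply: continuous_compact.
  apply: continuous_subspaceT => v B' /nbhs_ballP[e /= e0 eB].
  apply/nbhs_ballP; exists e => //= v' vv'; apply: eB; move: vv'.
  by rewrite -!ball_normE /= -linearB normT.
apply: bounded_closed_compact.
  exists B; split; first exact: num_real.
  by move=> x Bx v /= /le_trans; apply; exact: ltW.
rewrite (_ : mkset _ = (fun v : 'rV[R]_M => `|v|) @^-1` [set x | x <= B])//.
apply: closed_comp; last exact: closed_le.
by move=> v _; exact: norm_continuous.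
Qed.

(* A closed set is the complement of a countable union of boxes with rational
   centers. *)
Lemma measurable_preimage_closed {d} {T : measurableType d} (n : nat)
    (Y : T -> 'cV[R]_n) (C : set 'cV[R]_n) :
  (forall i, measurable_fun setT (fun w => Y w i 0)) -> closed C ->
  measurable (Y @^-1` C).
Proof.
move=> mY cC; rewrite -[X in measurable X]setCK; apply: measurableC.
rewrite preimage_setC.
pose box (q : 'cV[rat]_n * nat) : set 'cV[R]_n :=
  [set y | forall i, `|y i 0 - ratr (q.1 i 0)| < q.2.+1%:R^-1].
have mbox q : measurable (Y @^-1` box q).
  have -> : Y @^-1` box q = \bigcap_(i in [set: 'I_n])
      [set w | `|Y w i 0 - ratr (q.1 i 0)| < q.2.+1%:R^-1].
    by apply/seteqP; split => w /= h i; [move=> _|]; exact: h.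
  apply: fin_bigcap_measurable => // i _.
  set a := ratr _; set b := _^-1.
  rewrite (_ : mkset _ = (fun w => Y w i 0) @^-1` `]a - b, a + b[).
    by rewrite -[X in measurable X]setTI; exact: mY.
  by apply/seteqP; split => w /=; rewrite in_itv/= ltr_norml => /andP[? ?];
    apply/andP; split; lra.
have -> : Y @^-1` (~` C) = \bigcup_(q in [set: 'cV[rat]_n * nat])
    (if `[< box q `<=` ~` C >] then Y @^-1` box q else set0).
  apply/seteqP; split => [w Cw|w [q _]]; last by case: asboolP => // qC /qC.
  have oC : open (~` C) by rewrite openC.
  have /nbhs_ballP[e /= e0 eC] : nbhs (Y w) (~` C) by exact: open_nbhs_nbhs.
  (* A box of half-width h < e / 2 whose center is within h of [Y w] contains [Y w] and stays within
     2h < e of it. *)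
  have [k kP] : exists k : nat, 2 * k.+1%:R^-1 < e.
    have [|k] := @ltr_add_invr R 0 (e / 2); first by rewrite divr_gt0.
    by rewrite add0r => ke; exists k; rewrite mulrC -ltr_pdivlMr.
  have [h hE] : exists h : R, h = k.+1%:R^-1 by exists k.+1%:R^-1.
  have h0 : 0 < h by rewrite hE invr_gt0.
  rewrite -hE in kP.
  have /choice[q qP] (i : 'I_n) : exists q : rat, `|Y w i 0 - ratr q| < h.
    have lt : Y w i 0 - h < Y w i 0 + h by lra.
    have [q qI] := rat_in_itvoo lt; exists q; move: qI; rewrite in_itv/=.
    by rewrite ltr_norml => /andP[? ?]; apply/andP; split; lra.
  pose q' : 'cV[rat]_n := \col_i q i.
  exists (q', k) => //; rewrite ifT; first by move=> i; rewrite /= mxE -hE.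
  apply/asboolP => y yq; apply: eC; rewrite -ball_normE /=.
  apply: (@le_lt_trans _ _ (2 * h)) => //.
  apply: mx_norm_le => [|i j]; first by rewrite mulr_ge0// ltW.
  rewrite ord1 !mxE; have := yq i; rewrite /= mxE -hE; have := qP i.
  by rewrite !ltr_norml !ler_norml => /andP[? ?] /andP[? ?]; apply/andP; split; lra.
apply: countable_bigcupT_measurable => // q; by case: ifP.
Qed.

End ColumnTopology.

(** * Existence of a minimizer in a closed set as a measurable event *)

Section MinimizersMeasurable.
Context {R : realType} (n M : nat) {d : measure_display} {T : measurableType d}.
Context (F : set ('cV[R]_n * 'cV[R]_M)) (f : 'cV[R]_n * 'cV[R]_M -> R) (kappa : R).
Hypotheses (cF : closed F) (cf : continuous f) (kappa_gt0 : 0 < kappa).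
Hypothesis f_ge : forall y v, kappa * `|v| <= f (y, v).

Let sublevel (A : set 'cV[R]_M) (q : R) : set 'cV[R]_n :=
  [set y | exists v, [/\ A v, F (y, v) & f (y, v) <= q]].

Let f_bounded y v q : f (y, v) <= q -> `|v| <= q / kappa.
Proof. by move=> fq; rewrite ler_pdivlMr// mulrC (le_trans (f_ge y v)). Qed.

(** Coercivity confines the points of a sublevel set to a ball, so the projection is taken along a
    compact set. *)
Let closed_sublevel A q : closed A -> closed (sublevel A q).
Proof.
move=> cA.
rewrite (_ : sublevel A q = [set y | exists2 v, [set v : 'cV[R]_M | `|v| <= q / kappa] v &
   (snd @^-1` A `&` F `&` f @^-1` [set x | x <= q]) (y, v)]).
  apply: closed_proj; last exact: compact_cV_ball.
  apply: closedI; first apply: closedI => //.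
    by apply: closed_comp => // -[y v] _; exact: cvg_snd.
  by apply: closed_comp => [? _|]; [exact: cf|exact: closed_le].
apply/seteqP; split => [y [v [Av Fv fv]]|y [v _ [[Av Fv] fv]]]; exists v => //=.
exact: f_bounded fv.
Qed.

Let attained (A : set 'cV[R]_M) y v0 : closed A -> A v0 -> F (y, v0) ->
  exists v, [/\ A v, F (y, v) &
    forall v', A v' -> F (y, v') -> f (y, v) <= f (y, v')].
Proof.
move=> cA Av0 Fv0; have cpair : continuous (pair y : 'cV[R]_M -> _).
  move=> v B [[B1 B2] /= [nB1 nB2] BB]; apply: filterS nB2 => v' B2v'.
  by apply: (BB (y, v')); split => //=; exact: nbhs_singleton.
pose K := [set v | `|v| <= f (y, v0) / kappa] `&`
  (A `&` (pair y) @^-1` F `&` (f \o pair y) @^-1` [set x | x <= f (y, v0)]).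
have cfy : continuous (f \o pair y).
  by move=> v; apply: continuous_comp; [exact: cpair|exact: cf].
have cK : compact K.
  apply: compact_closedI; first exact: compact_cV_ball.
  apply: closedI; first apply: closedI => //.
    by apply: closed_comp => // v _; exact: cpair.
  by apply: closed_comp => [? _|]; [exact: cfy|exact: closed_le].
have K0 : K v0 by split; [exact: f_bounded|split => //=].
have [|v] := compact_EVT_min (ex_intro _ v0 K0) cK
    (_ : {within K, continuous (f \o pair y)}).
  exact: continuous_subspaceT.
rewrite inE => -[_ [[Av Fv] /= fv]] vmin; exists v; split => // v' Av' Fv'.
have [v'0|/ltW v0v'] := leP (f (y, v')) (f (y, v0)); last exact: le_trans fv v0v'.
by apply: vmin; rewrite inE; split; [exact: f_bounded v'0|split].
Qed.

(** Some minimizer lies in [A] exactly when [A] contains a feasible point and every rational level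
    reached by a feasible point is also reached by one in [A]. The minimum over [A] is attained, so
    the second condition makes it the global minimum. *)
Lemma measurable_exists_minimizer (Y : T -> 'cV[R]_n) (A : set 'cV[R]_M) :
  (forall i, measurable_fun setT (fun w => Y w i 0)) -> closed A ->
  measurable [set w | exists2 v, A v &
    minimizers [set v | F (Y w, v)] (fun v => f (Y w, v)) v].
Proof.
move=> mY cA; pose L A q := Y @^-1` sublevel A q.
have mL (B : set 'cV[R]_M) q : closed B -> measurable (L B q).
  by move=> cB; apply: measurable_preimage_closed => //; exact: closed_sublevel.
rewrite (_ : mkset _ = (\bigcup_(q in [set: rat]) L A (ratr q)) `&`
    \bigcap_(q in [set: rat]) (~` L setT (ratr q) `|` L A (ratr q))).
  apply: measurableI.
    by apply: bigcupT_measurable_rat => q; exact: mL.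
  rewrite -[X in measurable X]setCK setC_bigcap; apply: measurableC.
  apply: bigcupT_measurable_rat => q; apply: measurableC.
  by apply: measurableU; [apply: measurableC|]; apply: mL => //; exact: closedT.
apply/seteqP; split => w.
  move=> [v Av [Fv vmin]]; split.
    have lt1 : f (Y w, v) < f (Y w, v) + 1 by rewrite ltrDl.
    have [q] := rat_in_itvoo lt1; rewrite in_itv/= => /andP[/ltW vq _].
    by exists q => //; exists v.
  move=> q _; have [[v' [_ Fv' v'q]]|] := pselect (L setT (ratr q) w); last by left.
  right; exists v; split => //; exact: le_trans (vmin v' Fv') v'q.
move=> [[q0 _ [v0 [Av0 Fv0 _]]] h].
have [v [Av Fv vmin]] := attained cA Av0 Fv0.
exists v => //; split => // v' Fv'; rewrite leNgt; apply/negP => v'v.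
have [q] := rat_in_itvoo v'v; rewrite in_itv/= => /andP[v'q qv].
case: (h q Logic.I) => [|[v'' [Av'' Fv'' v''q]]].
  by apply; exists v'; split => //; exact: ltW.
by have := vmin v'' Av'' Fv''; rewrite leNgt (le_lt_trans v''q).
Qed.

End MinimizersMeasurable.

(** * Application to the Lasso and Dantzig solution sets *)

Section SupErrorMeasurable.
Context {R : realType} (n M : nat) (X : 'M[R]_(n, M)).

Let continuous_l1 : continuous (fun p : 'cV[R]_n * 'cV[R]_M => \sum_j `|p.2 j 0|).
Proof.
apply: continuous_big => [|j _]; first exact: add_continuous.
move=> p; apply: (@cvg_comp _ _ _ (fun p : 'cV[R]_n * 'cV[R]_M => p.2 j 0)).
  apply: (@cvg_comp _ _ _ snd (fun v : 'cV[R]_M => v j 0)); first exact: cvg_snd.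
  exact: coord_continuous.
exact: norm_continuous.
Qed.

Let continuous_residual i :
  continuous (fun p : 'cV[R]_n * 'cV[R]_M => (p.1 - X *m p.2) i 0).
Proof.
rewrite (_ : (fun p => _) = (fun p : 'cV[R]_n * 'cV[R]_M =>
    p.1 i 0 - \sum_k X i k * p.2 k 0)); last first.
  by apply/funext => p; rewrite !mxE.
move=> p; apply: cvgB.
  apply: (@cvg_comp _ _ _ fst (fun v : 'cV[R]_n => v i 0)); first exact: cvg_fst.
  exact: coord_continuous.
apply: cvg_big => [|k _]; first exact: add_continuous.
apply: cvgMl_tmp.
apply: (@cvg_comp _ _ _ snd (fun v : 'cV[R]_M => v k 0)); first exact: cvg_snd.
exact: coord_continuous.
Qed.

Let norm_le_l1 (v : 'cV[R]_M) : `|v| <= lp_norm 1 v.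
Proof.
rewrite lp_norm1E; apply: mx_norm_le => [|i j]; first exact: sumr_ge0.
by rewrite ord1 (bigD1 i)//= lerDl sumr_ge0.
Qed.

Let objective e r (p : 'cV[R]_n * 'cV[R]_M) : R :=
  match e with
  | Lasso => n%:R^-1 * lp_norm 2 (p.1 - X *m p.2) ^+ 2 + 2 * r * lp_norm 1 p.2
  | Dantzig => lp_norm 1 p.2
  end.

Let feasible e r : set ('cV[R]_n * 'cV[R]_M) :=
  match e with
  | Lasso => setT
  | Dantzig => [set p | `|n%:R^-1 *: (X^T *m (p.1 - X *m p.2))| <= r]
  end.

Let continuous_objective e r : continuous (objective e r).
Proof.
case: e; last first.
  rewrite (_ : objective _ _ = (fun p => \sum_j `|p.2 j 0|)) //.
  by apply/funext => p; exact: lp_norm1E.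
rewrite (_ : objective _ _ = (fun p => n%:R^-1 *
    (\sum_i (p.1 - X *m p.2) i 0 ^+ 2) + 2 * r * \sum_j `|p.2 j 0|)).
  move=> p; apply: cvgD; apply: cvgMl_tmp; last exact: continuous_l1.
  apply: cvg_big => [|i _]; first exact: add_continuous.
  apply: (@cvg_comp _ _ _ (fun p : 'cV[R]_n * 'cV[R]_M => (p.1 - X *m p.2) i 0)
    (@GRing.exp R ^~ 2)); first exact: continuous_residual.
  exact: exprn_continuous.
apply/funext => p.
by congr (_ * _ + _ * _); [exact: lp_norm2_sqr|exact: lp_norm1E].
Qed.

Let closed_feasible e r : 0 <= r -> closed (feasible e r).
Proof.
case: e => r0; first exact: closedT.
rewrite (_ : feasible _ _ = \bigcap_(j in [set: 'I_M])
    (fun p => `|n%:R^-1 * \sum_i X i j * (p.1 - X *m p.2) i 0|) @^-1`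
    [set x : R | x <= r]).
  apply: closed_bigI => j _; apply: closed_comp; last exact: closed_le.
  move=> p _; apply: (@cvg_comp _ _ _ (fun p : 'cV[R]_n * 'cV[R]_M =>
    n%:R^-1 * \sum_i X i j * (p.1 - X *m p.2) i 0)); last exact: norm_continuous.
  apply: cvgMl_tmp; apply: cvg_big => [|i _]; first exact: add_continuous.
  by apply: cvgMl_tmp; exact: continuous_residual.
have E (p : 'cV[R]_n * 'cV[R]_M) j : (n%:R^-1 *: (X^T *m (p.1 - X *m p.2))) j 0 =
    n%:R^-1 * \sum_i X i j * (p.1 - X *m p.2) i 0.
  by rewrite !mxE; congr (_ * _); apply: eq_bigr => i _; rewrite [X^T _ _]mxE.
apply/seteqP; split => p /= h.
  by move=> j _ /=; rewrite -E; apply: le_trans h; exact: mx_norm_entry_le.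
by apply: mx_norm_le => // j k; rewrite ord1 E; exact: h.
Qed.

(** The supremum exceeds [C] exactly when, for some k, a solution lies in the closed set of points
    at distance at least C + 1/(k+1) from [theta]. *)
Lemma measurable_sup_error {d} {T : measurableType d} (Y : T -> 'cV[R]_n)
    e (r C : R) (theta : 'cV[R]_M) :
  0 < r -> (forall i, measurable_fun setT (fun w => Y w i 0)) ->
  measurable [set w | (sup_error (solutions e X r (Y w)) theta <= C%:E)%E].
Proof.
move=> r0 mY.
pose A (k : nat) := [set v : 'cV[R]_M | C + k.+1%:R^-1 <= `|v - theta|].
have cA k : closed (A k).
  rewrite (_ : A k = (fun v => `|v - theta|) @^-1` [set x | C + k.+1%:R^-1 <= x])//.
  apply: closed_comp => [v _ B /nbhs_ballP[e' /= e0 eB]|]; last exact: closed_ge.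
  apply/nbhs_ballP; exists e' => //= v' vv'; apply: eB; move: vv'.
  rewrite -!ball_normE /=; apply: le_lt_trans; apply: le_trans (ler_dist_dist _ _) _.
  by rewrite opprB addrA subrK.
(* Coercivity comes from the l1 term alone, whose coefficient is 2r for the Lasso and 1 for
   Dantzig. *)
pose kappa := match e with Lasso => 2 * r | Dantzig => 1 end.
have kappa0 : 0 < kappa by rewrite /kappa; case: (e); rewrite ?mulr_gt0.
have obj_ge y v : kappa * `|v| <= objective e r (y, v).
  rewrite /kappa /objective; case: (e) => /=; last by rewrite mul1r norm_le_l1.
  rewrite -[leLHS]add0r lerD//.
    by rewrite mulr_ge0 ?invr_ge0 ?sqr_ge0.
  by rewrite ler_pM2l ?mulr_gt0// norm_le_l1.
have solE y : solutions e X r y =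
    minimizers [set v | feasible e r (y, v)] (fun v => objective e r (y, v)).
  by case: (e).
rewrite (_ : mkset _ = ~` \bigcup_k [set w | exists2 v, A k v &
    minimizers [set v | feasible e r (Y w, v)] (fun v => objective e r (Y w, v)) v]).
  apply: measurableC; apply: bigcupT_measurable => k.
  exact: (measurable_exists_minimizer (@closed_feasible e r (ltW r0))
    (@continuous_objective e r) kappa0 obj_ge mY (cA k)).
apply/seteqP; split => w /=.
  move=> sup_le [k _ [v Av]]; rewrite -solE => vsol.
  have : (`|v - theta|%:E <= C%:E)%E.
    by apply: le_trans sup_le; apply: ereal_sup_ubound; exists v.
  have k0 : 0 < k.+1%:R^-1 :> R by rewrite invr_gt0.
  by rewrite lee_fin leNgt (lt_le_trans _ Av)// ltrDl.
move=> h; apply: ge_ereal_sup => _ [v vsol <-]; rewrite lee_fin leNgt.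
apply/negP => Cv; apply: h; have [k Ck] := ltr_add_invr Cv.
by exists k => //; exists v; [exact: ltW|rewrite -solE].
Qed.

End SupErrorMeasurable.

(** * Choice of the exponent of the potential *)

Lemma ln2_ge_half {R : realType} : 2^-1 <= ln 2 :> R.
Proof.
rewrite -[leLHS]expRK ler_ln ?posrE ?expR_gt0//.
rewrite -[leLHS]invrK -expRN invf_ple ?posrE ?expR_gt0//.
by apply: le_trans (expR_ge1Dx _); lra.
Qed.

(** Take m one above the rounded-up binary logarithm u + 1 of M. As 2^u < M and ln 2 >= 1/2, one has
    u <= 2 ln M, and the remaining 2 is at most 4 ln M. *)
Lemma exists_exponent {R : realType} (M : nat) : (2 <= M)%N ->
  exists m, [/\ (0 < m)%N, (M <= 2 ^ m.-1)%N & m%:R <= 6 * ln M%:R :> R].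
Proof.
move=> M2; have /andP[ub lb] := up_log_bounds (isT : (1 < 2)%N) M2.
exists (up_log 2 M).+1; split => //.
have l2 := @ln2_ge_half R.
have lM : ln 2 <= ln M%:R :> R by rewrite ler_ln ?posrE ?ltr0n ?ler_nat// ltnW.
have : (up_log 2 M).-1%:R * ln 2 <= ln M%:R :> R.
  rewrite mulr_natl -lnXn// -natrX ler_ln ?posrE ?ltr0n ?ler_nat ?expn_gt0//.
    exact: ltnW.
  exact: ltnW.
have : (up_log 2 M).+1%:R <= (up_log 2 M).-1%:R + 2 :> R.
  by rewrite -natrD ler_nat; case: (up_log 2 M) => // k; rewrite addn2.
have : 0 <= (up_log 2 M).-1%:R :> R by rewrite ler0n.
set u := _.-1%:R => u0 h1 h2.
have : u * 2^-1 <= u * ln 2 by rewrite ler_wpM2l.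
by lra.
Qed.

(** * The tail of the noise score *)

(* The design is rescaled by [sqrt (n * sigma^2 * c')], which makes the second
   moments of the summands add up to at most 1, the value of the potential at 0. *)
Lemma noise_score_event {R : realType} (c' : R) (n M : nat) (sigma delta r : R)
    (X : 'M[R]_(n, M)) {d : measure_display} {T : measurableType d}
    (P : probability T R) (W : 'I_n -> {RV P >-> R}) :
  0 < c' -> (0 < n)%N -> (2 <= M)%N -> 0 < sigma ->
  mutually_independent W ->
  (forall i, (\int[P]_w (W i w)%:E = 0)%E) ->
  (forall i, (\int[P]_w (W i w ^+ 2)%:E <= (sigma ^+ 2)%:E)%E) ->
  r = sigma * Num.sqrt (ln M%:R `^ (1 + delta) / n%:R) ->
  n%:R^-1 * \sum_(i < n) \big[Num.max/0]_(j < M) (`|X i j| ^+ 2) <= c' ->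
  exists2 A, measurable A &
  (P (~` A) <= (312 * c' / ln M%:R `^ delta)%:E)%E /\
  forall w, A w -> `|n%:R^-1 *: (X^T *m \col_i W i w)| <= r / 2.
Proof.
move=> c'0 n0 M2 sigma0 indepW meanW varW rE hX.
have nR0 : 0 < n%:R :> R by rewrite ltr0n.
have lnM0 : 0 < ln M%:R :> R by rewrite ln_gt0// ltr1n.
have [m [m0 Mm mln]] := @exists_exponent R M M2.
pose L := ln M%:R `^ (1 + delta); have L0 : 0 < L by exact: powR_gt0.
pose rho2 := n%:R * sigma ^+ 2 * c'.
have rho20 : 0 < rho2 by rewrite !mulr_gt0// exprn_gt0.
pose rho := Num.sqrt rho2; have rho0 : 0 < rho by rewrite sqrtr_gt0.
have rhoE : rho ^+ 2 = rho2 by rewrite sqr_sqrtr ?ltW.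
pose mx i := \big[Num.max/0]_(j < M) (`|X i j| ^+ 2).
have mx0 i : 0 <= mx i by exact: bigmax_ge_id.
pose eta i := Num.sqrt (mx i) / rho.
have x_le i j : `|X i j / rho| <= eta i.
  rewrite normrM normfV (gtr0_norm rho0) ler_wpM2r ?invr_ge0 ?(ltW rho0)//.
  rewrite -(sqrtr_sqr (X i j)) ler_wsqrtr// -real_normK ?num_real//.
  exact: (le_bigmax _ (fun j => `|X i j| ^+ 2) j).
(* The threshold solves (rho / n)^2 t = (r / 2)^2. *)
pose t := L / (4 * c'); have t0 : 0 < t by rewrite divr_gt0// mulr_gt0.
have [A mA [PA AE]] := @sum_sqr_tail R d T P n M m W (fun i j => X i j / rho)
  eta sigma m0 Mm indepW meanW varW x_le t t0.
exists A => //; split.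
  apply: le_trans PA _; rewrite lee_fin.
  have s2 : 0 < sigma ^+ 2 by rewrite exprn_gt0.
  have eta_sum : sigma ^+ 2 * \sum_i eta i ^+ 2 <= 1.
    have -> : \sum_i eta i ^+ 2 = (\sum_i mx i) / rho2.
      rewrite mulr_suml; apply: eq_bigr => i _.
      by rewrite /eta exprMn exprVn rhoE sqr_sqrtr.
    rewrite mulrA ler_pdivrMr// mul1r /rho2.
    have := hX; rewrite mulrC ler_pdivrMr// => hX'.
    by rewrite [leRHS]mulrAC [leRHS]mulrC ler_pM2l// [leRHS]mulrC.
  (* Here 1 + 12 m <= 13 m and m <= 6 ln M, so the constant is 13 * 6 = 78. *)
  have KE : 1 + 12 * m%:R * sigma ^+ 2 * \sum_i eta i ^+ 2 <= 78 * ln M%:R.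
    apply: (@le_trans _ _ (1 + 12 * m%:R * 1)).
      by rewrite lerD2l -[leLHS]mulrA ler_wpM2l// mulr_ge0 ?ler0n.
    have : 1 <= m%:R :> R by rewrite ler1n.
    by move: mln; lra.
  (* One factor ln M of [L] cancels the ln M coming from m, which leaves the power [delta]; the 4 c'
     in [t] turns 78 into 312 c'. *)
  have LE : L = ln M%:R * ln M%:R `^ delta.
    rewrite /L powRD; last by rewrite (gt_eqF lnM0) implybT.
    by rewrite powRr1// ltW.
  have D0 : 0 < ln M%:R `^ delta :> R by exact: powR_gt0.
  apply: (@le_trans _ _ (78 * ln M%:R / t)).
    by rewrite ler_wpM2r ?invr_ge0 ?(ltW t0).
  rewrite le_eqVlt; apply/orP; left; apply/eqP; rewrite /t LE.
  by field; rewrite ?gt_eqF.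
move=> w /AE h.
have r0 : 0 <= r / 2 by rewrite rE divr_ge0// mulr_ge0 ?sqrtr_ge0 ?ltW.
apply: mx_norm_le => // j k; rewrite ord1 {k}.
rewrite -(@ler_pXn2r _ 2)// ?nnegrE// real_normK ?num_real//.
have -> : (n%:R^-1 *: (X^T *m \col_i W i w)) j 0 =
    n%:R^-1 * rho * \sum_i X i j / rho * W i w.
  rewrite mxE mxE !mulr_sumr; apply: eq_bigr => i _.
  by rewrite !mxE; field; rewrite ?gt_eqF.
rewrite exprMn; apply: (@le_trans _ _ ((n%:R^-1 * rho) ^+ 2 * t)).
  by rewrite ler_wpM2l ?sqr_ge0.
rewrite exprMn rhoE [leRHS]exprMn rE [in leRHS]exprMn sqr_sqrtr; last first.
  by rewrite divr_ge0// ltW.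
rewrite -/L le_eqVlt; apply/orP; left; apply/eqP; rewrite /t /rho2.
by field; rewrite ?gt_eqF.
Qed.

Theorem theorem3 (R : realType) (c' : R) (hc' : 0 < c') :
  exists c : R, 0 < c /\
  forall (n M : nat) (hn : (1 <= n)%N) (hM : (2 <= M)%N)
    (sigma : R) (hsigma : 0 < sigma)
    (X : 'M[R]_(n, M)) (thetastar : 'cV[R]_M)
    (d : measure_display) (T : measurableType d) (P : probability T R)
    (W : 'I_n -> {RV P >-> R})
    (hindep : mutually_independent W)
    (hmean : forall i : 'I_n, ('E_P[W i] = 0)%E)
    (hvar : forall i : 'I_n, ('E_P[fun w => (W i w ^+ 2)%R] <= (sigma ^+ 2)%:E)%E)
    (Y : T -> 'cV[R]_n)
    (hY : forall w : T, Y w = X *m thetastar + \col_(i < n) W i w)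
    (e : estimator)
    (delta : R) (hdelta : 0 < delta)
    (r : R) (hr : r = sigma * Num.sqrt (ln M%:R `^ (1 + delta) / n%:R))
    (s : nat) (hs : (1 <= s)%N) (alpha : R) (halpha : 1 < alpha)
    (hdiag : forall j : 'I_M, gram X j j = 1)
    (hoff : \big[Num.max/0]_(ij : 'I_M * 'I_M | ij.1 != ij.2) `|gram X ij.1 ij.2|
            <= 1 / (alpha * (1 + 2 * c0 R e) * s%:R))
    (hsparse : (sparsity thetastar <= s)%N)
    (hX : n%:R^-1 * \sum_(i < n) \big[Num.max/0]_(j < M) (`|X i j| ^+ 2) <= c'),
  let E := [set w : T |
    (sup_error (solutions e X r (Y w)) thetastar <= (c2 e alpha * r)%:E)%E] in
  measurable E /\ ((1 - c / ln M%:R `^ delta)%:E <= P E)%E.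
Proof.
exists (312 * c'); split; first by rewrite mulr_gt0.
move=> n M hn hM sigma hsigma X thetastar d T P W hindep hmean hvar Y hY e delta
  hdelta r hr s hs alpha halpha hdiag hoff hsparse hX E.
have lnM0 : 0 < ln M%:R :> R by rewrite ln_gt0// ltr1n.
have r0 : 0 < r.
  by rewrite hr mulr_gt0// sqrtr_gt0 divr_gt0 ?powR_gt0 ?ltr0n.
have mE : measurable E.
  apply: measurable_sup_error => // i.
  rewrite (_ : (fun w => _) = (fun w => (X *m thetastar) i 0 + W i w)).
    exact: measurable_funD.
  by apply/funext => w; rewrite hY [LHS]mxE; congr (_ + _); rewrite mxE.
split => //.
have meanW i : (\int[P]_w (W i w)%:E = 0)%E by have := hmean i; rewrite unlock.
have varW i : (\int[P]_w (W i w ^+ 2)%:E <= (sigma ^+ 2)%:E)%E.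
  by have := hvar i; rewrite unlock.
have [A mA [PA AE]] := noise_score_event hc' hn hM hsigma hindep meanW varW hr hX.
(* The noise event [A] is contained in [E]: on it the deterministic bound holds for every solution
   at once, hence for the supremum. *)
apply: (@le_trans _ _ (P A)); last first.
  apply: le_measure; rewrite ?inE// => w /AE w_le.
  apply: ge_ereal_sup => _ [theta sol <-]; rewrite lee_fin.
  apply: (solution_error r0 hs halpha hdiag hoff hsparse w_le).
  by rewrite -hY.
rewrite EFinB leeBlDr// addeC -leeBlDr ?fin_num_measure//.
by have := probability_setC P mA => <-.
Qed.
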